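(* Let $\mathcal C_C=(\mathcal C,1_{\mathcal C},\underline M,K)$ be a homotopy probability algebra admitting an expectation $\mathfrak c$, and let $H$ be the cohomology of $(\mathcal C,K)$ with $1_H=[1_{\mathcal C}]\neq0$. Then there exists a unital $sL_\infty$-morphism $\underline\varphi:(H,1_H,\underline0)\to(\mathcal C,1_{\mathcal C},\underline\ell^K)$ whose first component $\varphi_1:(H,0)\to(\mathcal C,K)$ is a cochain quasi-isomorphism (inducing the identity on cohomology). That is, the descendant unital $sL_\infty$-algebra $(\mathcal C,1_{\mathcal C},\underline\ell^K)$ is quasi-isomorphic to its cohomology with the zero $sL_\infty$-structure.
   Context: Conventions: $\Bbbk$ is a field of characteristic zero; vector spaces are $\mathbb Z$-graded. $P(n)$ is the set of partitions of $[n]$, written $\pi=B_1\sqcup\dots\sqcup B_{|\pi|}$ with blocks ordered by increasing maximal element, each block increasing. For $B=\{j_1<\dots<j_r\}$, $f(x_B)=f_r(x_{j_1},\dots,x_{j_r})$, $|x_B|=\sum_{j\in B}|x_j|$. $\epsilon(\pi)$ is the Koszul sign of rearranging $x_1\otimes\dots\otimes x_n$ into $x_{B_1}\otimes\dots\otimes x_{B_{|\pi|}}$; $\epsilon(\pi,i)=\epsilon(\pi)(-1)^{|x_{B_1}|+\dots+|x_{B_{i-1}}|}$. A sum ''over $\pi\in P(n)$, $|B_i|=n-|\pi|+1$'' ranges over pairs $(\pi,i)$ with all blocks other than $B_i$ singletons. A unital $sL_\infty$-algebra $(V,1_V,\underline\ell)$: $1_V\in V^0$, degree-$1$ $\ell_n:S^nV\to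 V$ with $\sum_{\pi\in P(n),|B_i|=n-|\pi|+1}\epsilon(\pi,i)\ell_{|\pi|}(x_{B_1},\dots,\ell(x_{B_i}),\dots,x_{B_{|\pi|}})=0$ and $\ell_n(x_1,\dots,x_{n-1},1_V)=0$. A unital $sL_\infty$-morphism: degree-$0$ $\phi_n:S^nV\to V'$ with $\sum_{\pi\in P(n)}\epsilon(\pi)\ell'_{|\pi|}(\phi(x_{B_1}),\dots,\phi(x_{B_{|\pi|}}))=\sum_{\pi\in P(n),|B_i|=n-|\pi|+1}\epsilon(\pi,i)\phi_{|\pi|}(x_{B_1},\dots,\ell(x_{B_i}),\dots,x_{B_{|\pi|}})$, $\phi_1(1_V)=1_{V'}$, $\phi_k(x_1,\dots,x_{k-1},1_V)=0$ for $k\ge2$. Homotopy probability algebra $(\mathcal C,1_{\mathcal C},\underline M,K)$: $1_{\mathcal C}\in\mathcal C^0$; degree-$0$ $M_n:S^n\mathcal C\to\mathcal C$, $M_1=\mathrm{id}$, $M_{n+1}(x_1..x_n,1_{\mathcal C})=M_n(x_1..x_n)$; $K$ degree $1$, $K^2=0$, $K1_{\mathcal C}=0$, $1_{\mathcal C}\notin\operatorname{im}K$. An expectation is a degree-$0$ linear $\mathfrak c:\mathcal C\to\Bbbk$ with $\mathfrak c(1_{\mathcal C})=1$, $\mathfrak c\circ K=0$. Descendant $\ell^K_n$ (degree 1): recursively $KM_n(x_1..x_n)=\sum_{\pi\in P(n),|B_i|=n-|\pi|+1}\epsilon(\pi,i)M_{|\pi|}(x_{B_1},\dots,\ell^K(x_{B_i}),\dots,x_{B_{|\pi|}})$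 (so $\ell^K_1=K$). *)

(* Defs.v *)
From HB Require Import structures.
From mathcomp Require Import all_boot all_order all_algebra.
Set Implicit Arguments. Unset Strict Implicit. Unset Printing Implicit Defensive.
Import Order.TTheory GRing.Theory Num.Theory.
Local Open Scope ring_scope.

(* Z-graded vector spaces.  A graded space is an lmodType V over k with *)
(* a family of degree projections pr d : V -> V realising              *)
(* V = (+)_d V^d  (orthogonal idempotents, every vector is a finite    *)
(* sum of its homogeneous components).                                 *)
Definition is_grading (k : fieldType) (V : lmodType k) (pr : int -> V -> V) : Prop :=
  [/\ (forall d (a : k) (u v : V), pr d (a *: u + v) = a *: pr d u + pr d v),
      (forall d e (v : V), pr d (pr e v) = if d == e then pr e v else 0)
    & (forall v : V, exists s : seq int, uniq s /\ v = \sum_(d <- s) pr d v)].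

Definition homog (k : fieldType) (V : lmodType k) (pr : int -> V -> V) (d : int) (v : V) : Prop :=
  pr d v = v.

Definition sgn2 (k : fieldType) (a b : int) : k :=
  if odd (absz a) && odd (absz b) then -1 else 1.
Definition sgn1 (k : fieldType) (a : int) : k :=
  if odd (absz a) then -1 else 1.

Definition args (V : Type) n (x : 'I_n -> V) : seq V := [seq x i | i <- enum 'I_n].

(* Maps S^n V -> W are represented by one function f : seq V -> W, *)
(* f applied to a list of length n being the component f_n.         *)
Definition multilinear (k : fieldType) (V W : lmodType k) (f : seq V -> W) : Prop :=
  forall (l r : seq V) (a : k) (u v : V),
    f (l ++ (a *: u + v) :: r) = a *: f (l ++ u :: r) + f (l ++ v :: r).

Definition graded_sym (k : fieldType) (V W : lmodType k) (prV : int -> V -> V)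
    (f : seq V -> W) : Prop :=
  forall (l r : seq V) (u v : V) (du dv : int),
    homog prV du u -> homog prV dv v ->
    f (l ++ u :: v :: r) = sgn2 k du dv *: f (l ++ v :: u :: r).

Definition has_degree (k : fieldType) (V W : lmodType k) (prV : int -> V -> V)
    (prW : int -> W -> W) (deg : int) (f : seq V -> W) : Prop :=
  forall n (x : 'I_n -> V) (ds : 'I_n -> int), (0 < n)%N ->
    (forall i, homog prV (ds i) (x i)) ->
    homog prW ((\sum_(i < n) ds i) + deg) (f (args x)).

Definition bmax n (B : {set 'I_n}) : nat := \max_(i in B) (i : nat).

Definition blocks n (P : {set {set 'I_n}}) : seq {set 'I_n} :=
  sort (fun A B => (bmax A <= bmax B)%N) (enum P).

Definition xB (V : Type) n (x : 'I_n -> V) (B : {set 'I_n}) : seq V :=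
  [seq x j | j <- enum B].

Definition degB n (ds : 'I_n -> int) (B : {set 'I_n}) : int := \sum_(j in B) ds j.

(* Koszul sign of rearranging x_1 .. x_n into the order given by s *)
Fixpoint kz (k : fieldType) n (ds : 'I_n -> int) (s : seq 'I_n) : k :=
  match s with
  | [::] => 1
  | a :: s' => (\prod_(b <- s' | (b < a)%N) sgn2 k (ds a) (ds b)) * kz k ds s'
  end.

Definition epsP (k : fieldType) n (ds : 'I_n -> int) (P : {set {set 'I_n}}) : k :=
  kz k ds (flatten (map (fun B : {set 'I_n} => enum B) (blocks P))).

(* epsilon(pi, i), blocks numbered from 0 *)
Definition epsPi (k : fieldType) n (ds : 'I_n -> int) (P : {set {set 'I_n}}) (i : nat) : k :=
  epsP k ds P * sgn1 k (\sum_(j < i) degB ds (nth set0 (blocks P) j)).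

Definition others_single n (bl : seq {set 'I_n}) (i : nat) : bool :=
  all (fun j => (j == i) || (#|nth set0 bl j| == 1%N)) (iota 0 (size bl)).

Definition ins (V : Type) n (g : seq V -> V) (x : 'I_n -> V) (bl : seq {set 'I_n}) (i : nat)
  : seq V :=
  flatten [seq (if j == i then [:: g (xB x (nth set0 bl j))] else xB x (nth set0 bl j))
          | j <- iota 0 (size bl)].

(* sum over pi in P(n), |B_i| = n - |pi| + 1, of
   eps(pi,i) outer(x_{B_1}, ..., g(x_{B_i}), ..., x_{B_|pi|}) *)
Definition sumPi (k : fieldType) (V W : lmodType k) n (ds : 'I_n -> int) (x : 'I_n -> V)
    (outer : seq V -> W) (g : seq V -> V) : W :=
  \sum_(P : {set {set 'I_n}} | partition P [set: 'I_n])
    \sum_(i <- iota 0 (size (blocks P)) | others_single (blocks P) i)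
      epsPi k ds P i *: outer (ins g x (blocks P) i).

Definition sumP (k : fieldType) (V W : lmodType k) n (ds : 'I_n -> int) (x : 'I_n -> V)
    (l' : seq W -> W) (phi : seq V -> W) : W :=
  \sum_(P : {set {set 'I_n}} | partition P [set: 'I_n])
    epsP k ds P *: l' (map (fun B : {set 'I_n} => phi (xB x B)) (blocks P)).

Definition is_unital_sLinf_morphism (k : fieldType) (V W : lmodType k)
    (prV : int -> V -> V) (prW : int -> W -> W) (oneV : V) (oneW : W)
    (l : seq V -> V) (l' : seq W -> W) (phi : seq V -> W) : Prop :=
  [/\ [/\ multilinear phi, graded_sym prV phi & has_degree prV prW 0 phi],
      (forall n (x : 'I_n -> V) (ds : 'I_n -> int), (0 < n)%N ->
         (forall i, homog prV (ds i) (x i)) ->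
         sumP ds x l' phi = sumPi ds x phi l),
      phi [:: oneV] = oneW
    & (forall xs : seq V, xs != [::] -> phi (rcons xs oneV) = 0)].

Definition is_hpa (k : fieldType) (C : lmodType k) (prC : int -> C -> C)
    (oneC : C) (M : seq C -> C) (K : C -> C) : Prop :=
  [/\ homog prC 0 oneC,
      [/\ multilinear M, graded_sym prC M, has_degree prC prC 0 M,
          (forall x : C, M [:: x] = x)
        & (forall xs : seq C, xs != [::] -> M (rcons xs oneC) = M xs)],
      [/\ (forall (a : k) (u v : C), K (a *: u + v) = a *: K u + K v),
          (forall d v, homog prC d v -> homog prC (d + 1) (K v))
        & (forall v, K (K v) = 0)]
    & K oneC = 0 /\ ~ (exists v, K v = oneC)].

Definition is_expectation (k : fieldType) (C : lmodType k) (prC : int -> C -> C)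
    (oneC : C) (K : C -> C) (c : C -> k) : Prop :=
  [/\ (forall (a : k) (u v : C), c (a *: u + v) = a * c u + c v),
      (forall d v, d != 0 -> homog prC d v -> c v = 0),
      c oneC = 1
    & (forall v, c (K v) = 0)].

(* lK is the descendant family l^K: it satisfies the defining recursion
   K M_n(x) = sum_{pi, |B_i| = n-|pi|+1} eps(pi,i) M_|pi|(.., l^K(x_{B_i}), ..)
   on all homogeneous inputs (which determines it uniquely there). *)
Definition is_descendant (k : fieldType) (C : lmodType k) (prC : int -> C -> C)
    (M : seq C -> C) (K : C -> C) (lK : seq C -> C) : Prop :=
  forall n (x : 'I_n -> C) (ds : 'I_n -> int), (0 < n)%N ->
    (forall i, homog prC (ds i) (x i)) ->
    K (M (args x)) = sumPi ds x M lK.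

Definition is_cohomology (k : fieldType) (C H : lmodType k) (prC : int -> C -> C)
    (K : C -> C) (prH : int -> H -> H) (p : C -> H) : Prop :=
  [/\ (forall (a : k) (u v : C), p (a *: u + v) = a *: p u + p v),
      (forall d z, homog prC d z -> K z = 0 -> homog prH d (p z)),
      (forall d h, homog prH d h -> exists z, [/\ homog prC d z, K z = 0 & p z = h])
    & (forall z, K z = 0 -> (p z = 0 <-> exists y, z = K y))].

(* Main.v *)
(* A family [M] of graded symmetric operations with [M_1 = id] is an
   sL_infinity isomorphism from the descendant algebra to [(C, K, 0, ...)], so
   morphisms [phi] from [H] to the descendant correspond to families of moments
   [Phi_n = sum_pi eps(pi) M(phi(x_B1), ..., phi(x_Bk))] with values in [ker K].
   Unitality of [phi] becomes [Phi_{n+1}(1, x) = Phi_n(x)].  With [f] a section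
   of [ker K -> H] such that [f(1) = 1], and [a] the expectation composed with
   [f], one may take
     [Phi_n(x) = sum_i (prod_{j <> i} a(x_j)) (f(x_i) - a(x_i) 1) + (prod_i a(x_i)) 1];
   [phi] is then its inverse transform, as cumulants are obtained from moments. *)
Require Import Defs.
From HB Require Import structures.
From mathcomp Require Import all_boot all_order all_algebra.
From mathcomp Require Import ring zify.
From mathcomp Require boolp classical_sets.
Import GRing.Theory.
Local Open Scope ring_scope.

Set Implicit Arguments.
Unset Strict Implicit.
Unset Printing Implicit Defensive.

(** The formula for [Phi] is an iterated product. Write [f(x) = a(x) 1 + (f(x) - a(x) 1)] and
    multiply in the algebra spanned by 1 and the centered parts, where any two centered parts have
    product zero. This product is commutative, has unit [1 = f(1)] and stays in the span of 1 and
    the image of [f], hence in [ker K]. It is also graded commutative because [a] vanishes off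
    degree 0: odd vectors are centered, so two of them multiply to zero and the sign is harmless.

    That moments in [ker K] give a morphism rests on one signed identity, [psum_bsum]: partitioning
    a list and then dividing the blocks into two groups amounts to dividing the list and then
    partitioning each part. It is awkward for sets of sets, so the sums are redefined by recursion
    on the least letter and compared once with the given definitions. A second obstacle is that the
    equation for [lK] holds on homogeneous arguments only. Letters therefore carry a degree,
    cumulants are built on labelled vectors, and linear extension comes last. *)

Section Signs.
Context {k : fieldType}.
Implicit Types a b c : int.

Lemma odd_abszD a b : odd (absz (a + b)) = odd (absz a) (+) odd (absz b).
Proof. lia. Qed.

Lemma sgn2C a b : sgn2 k a b = sgn2 k b a.
Proof. by rewrite /sgn2 andbC. Qed.

Lemma sgn2Dl a b c : sgn2 k (a + b) c = sgn2 k a c * sgn2 k b c.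
Proof.
rewrite /sgn2 odd_abszD; case: (odd `|a|); case: (odd `|b|); case: (odd `|c|) => /=; ring.
Qed.

Lemma sgn2Dr a b c : sgn2 k c (a + b) = sgn2 k c a * sgn2 k c b.
Proof. by rewrite sgn2C sgn2Dl !(sgn2C c). Qed.

Lemma sgn2_0l a : sgn2 k 0 a = 1.
Proof. by []. Qed.

Lemma sgn2_0r a : sgn2 k a 0 = 1.
Proof. by rewrite sgn2C. Qed.

Lemma sgn2_sqr a b : sgn2 k a b * sgn2 k a b = 1.
Proof. by rewrite /sgn2; case: ifP => _; ring. Qed.

End Signs.

Definition linear_map (k : fieldType) (V W : lmodType k) (h : V -> W) :=
  forall (a : k) u v, h (a *: u + v) = a *: h u + h v.

Section LinearMap.
Context {k : fieldType} {V W : lmodType k} {h : V -> W}.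
Hypothesis hL : linear_map h.

Lemma linear_map0 : h 0 = 0.
Proof. by have := hL (-1) 0 0; rewrite scaler0 add0r scaleN1r addNr. Qed.

Lemma linear_mapD u v : h (u + v) = h u + h v.
Proof. by rewrite -[u in LHS]scale1r hL scale1r. Qed.

Lemma linear_mapZ a u : h (a *: u) = a *: h u.
Proof. by rewrite -[X in h X]addr0 hL linear_map0 addr0. Qed.

Lemma linear_mapB u v : h (u - v) = h u - h v.
Proof. by rewrite linear_mapD -scaleN1r linear_mapZ scaleN1r. Qed.

Lemma linear_map_sum (I : Type) (r : seq I) (F : I -> V) :
  h (\sum_(i <- r) F i) = \sum_(i <- r) h (F i).
Proof. exact: (big_morph h linear_mapD linear_map0). Qed.

End LinearMap.

(** * Signed sums over partitions and unshuffles of a list *)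

Section SignedSums.
Context {k : fieldType} {T : Type} (deg : T -> int) {W : lmodType k}.
Implicit Types (x y : T) (s t : seq T) (L P : seq (seq T)).

Definition degs s : int := \sum_(x <- s) deg x.

Lemma degs_nil : degs [::] = 0. Proof. exact: big_nil. Qed.
Lemma degs_cons x s : degs (x :: s) = deg x + degs s. Proof. exact: big_cons. Qed.
Lemma degs_cat s t : degs (s ++ t) = degs s + degs t. Proof. exact: big_cat. Qed.

(** The sign moves [x] past the blocks before the one that receives it. The summand is a
    continuation, rebuilt along the recursion, so that sums are exchanged by induction and without
    index sets. *)
Fixpoint isum x L (F : seq (seq T) -> W) : W :=
  if L is B :: L' then
    F ((x :: B) :: L') + sgn2 k (deg x) (degs B) *: isum x L' (fun P => F (B :: P))
  else 0.

(* Inserting the least element [x] into a partition of the rest, either in a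
   block of its own placed first or in an existing block, keeps the blocks
   ordered by their maxima. *)
Fixpoint psum s (F : seq (seq T) -> W) : W :=
  if s is x :: s' then psum s' (fun L => F ([:: x] :: L) + isum x L F) else F [::].

(** Signed unshuffles into two sublists: a letter sent to the right part passes over the letters of
    the left part, all of which come after it in [s]. *)
Fixpoint usum s (F : seq T -> seq T -> W) : W :=
  if s is x :: s' then
    usum s' (fun a b => F (x :: a) b + sgn2 k (deg x) (degs a) *: F a (x :: b))
  else F [::] [::].

(** Such predicates pass from the summands to a signed sum; they are used for vanishing and for
    homogeneity of a given degree. *)
Definition is_subspace (Q : W -> Prop) :=
  Q 0 /\ forall (a : k) u v, Q u -> Q v -> Q (a *: u + v).

Definition nonnil (B : seq T) := size B != 0%N.

(** All that a summand needs to know of its partition: lengths for inductions on size, degrees for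
    signs. *)
Definition blocks_of s L :=
  [/\ size (flatten L) = size s, all nonnil L
    & degs (flatten L) = degs s].

Lemma subspaceD {Q : W -> Prop} (Qs : is_subspace Q) u v : Q u -> Q v -> Q (u + v).
Proof. by move=> Qu Qv; rewrite -[u]scale1r; apply: Qs.2. Qed.

Lemma subspaceZ {Q : W -> Prop} (Qs : is_subspace Q) (a : k) u : Q u -> Q (a *: u).
Proof. by move=> Qu; rewrite -[_ *: _]addr0; apply: Qs.2 => //; apply: Qs.1. Qed.

Lemma isum_ind {Q : W -> Prop} (Qs : is_subspace Q) x L F :
  (forall L1 B L2, L = L1 ++ B :: L2 -> Q (F (L1 ++ (x :: B) :: L2))) ->
  Q (isum x L F).
Proof.
elim: L F => [|B L IH] F QF /=; first exact: Qs.1.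
apply: subspaceD => //; first exact: (QF [::]).
apply: subspaceZ => //; apply: IH => L1 B' L2 eL.
by apply: (QF (B :: L1)); rewrite eL.
Qed.

Lemma psum_ind {Q : W -> Prop} (Qs : is_subspace Q) s F :
  (forall L, blocks_of s L -> Q (F L)) -> Q (psum s F).
Proof.
elim: s F => [|x s IH] F QF /=; first by apply: QF; split.
apply: IH => L [sL aL dL]; apply: subspaceD => //.
  by apply: QF; split; rewrite /= ?sL // !degs_cons dL.
apply: isum_ind => // L1 B L2 eL; apply: QF.
move: sL aL dL; rewrite /blocks_of eL !flatten_cat /= !all_cat !size_cat /=.
rewrite !size_cat !degs_cat !degs_cons !degs_cat => sL /and3P [a1 _ a2] dL.
split; [lia | by rewrite a1 | rewrite -dL; ring].
Qed.

Lemma isumD x L F G : isum x L (fun P => F P + G P) = isum x L F + isum x L G.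
Proof.
elim: L F G => [|B L IH] F G /=; first by rewrite addr0.
by rewrite IH scalerDr addrACA.
Qed.

Lemma eq_isum x L F G :
  (forall L1 B L2, L = L1 ++ B :: L2 -> F (L1 ++ (x :: B) :: L2) = G (L1 ++ (x :: B) :: L2)) ->
  isum x L F = isum x L G.
Proof.
elim: L F G => [|B L IH] F G E //=; congr (_ + _ *: _); first exact: (E [::]).
by apply: IH => L1 B' L2 eL; apply: (E (B :: L1)); rewrite eL.
Qed.

Lemma psumD s F G : psum s (fun P => F P + G P) = psum s F + psum s G.
Proof.
elim: s F G => [|x s IH] F G //=; rewrite -IH; congr psum.
by apply: boolp.funext => L; rewrite isumD addrACA.
Qed.

Lemma usumD s F G : usum s (fun a b => F a b + G a b) = usum s F + usum s G.
Proof.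
elim: s F G => [|x s IH] F G //=; rewrite -IH; congr usum.
by apply: boolp.funext => a; apply: boolp.funext => b; rewrite scalerDr addrACA.
Qed.

End SignedSums.

Section SignedSumsLinear.
Context {k : fieldType} {T : Type} (deg : T -> int) {W W' : lmodType k}.
Variables (h : W -> W') (hL : linear_map h).

Lemma isum_linear x L F : h (isum deg x L F) = isum deg x L (fun P => h (F P)).
Proof.
elim: L F => [|B L IH] F /=; first exact: linear_map0.
by rewrite (linear_mapD hL) (linear_mapZ hL) IH.
Qed.

Lemma psum_linear s F : h (psum deg s F) = psum deg s (fun P => h (F P)).
Proof.
elim: s F => [|x s IH] F //=; rewrite IH; congr psum.
by apply: boolp.funext => L; rewrite (linear_mapD hL) isum_linear.
Qed.

End SignedSumsLinear.

Section SignedSumsTheory.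
Context {k : fieldType} {T : Type} (deg : T -> int) {W : lmodType k}.
Implicit Types (x y : T) (s t : seq T) (L P : seq (seq T)).
Implicit Types F G : seq (seq T) -> W.
Notation degs := (degs deg).
Notation isum := (isum deg).
Notation psum := (psum deg).
Notation usum := (usum deg).
Notation eps a b := (sgn2 k a b).

Lemma scale_linear_map (a : k) : @linear_map k W W (fun u => a *: u).
Proof. by move=> b u v; rewrite scalerDr !scalerA mulrC. Qed.

Lemma isumZ x L a F : isum x L (fun P => a *: F P) = a *: isum x L F.
Proof. exact/esym/(isum_linear _ (scale_linear_map a)). Qed.

Lemma psumZ s a F : psum s (fun P => a *: F P) = a *: psum s F.
Proof. exact/esym/(psum_linear _ (scale_linear_map a)). Qed.

Lemma isum0 x L : isum x L (fun=> 0 : W) = 0.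
Proof. by have := isumZ x L 0 (fun=> 0 : W); rewrite !scale0r. Qed.

Lemma subspace0 : is_subspace (fun u : W => u = 0).
Proof. by split=> // a u v -> ->; rewrite scaler0 addr0. Qed.

Lemma psum0 s F : (forall L, blocks_of deg s L -> F L = 0) -> psum s F = 0.
Proof. by move=> F0; apply: (psum_ind subspace0). Qed.

Lemma eq_psum s F G : (forall L, blocks_of deg s L -> F L = G L) -> psum s F = psum s G.
Proof.
move=> E; apply/eqP; rewrite -subr_eq0 -scaleN1r -psumZ -psumD; apply/eqP.
by apply: psum0 => L /E ->; rewrite scaleN1r subrr.
Qed.

(** Isolates the one-block partition, which carries the leading term both when moments are solved
    for cumulants and when the descendant recursion is solved for [lK]. In the proof, [F'] records
    that [x] either forms the only block or joins it. *)
Lemma psum_le1 s F :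
  psum s (fun L => if (size L <= 1)%N then F L else 0) =
  F (if s is [::] then [::] else [:: s]).
Proof.
elim: s F => [|x s IH] F //=.
pose F' L := F (if L is B :: L' then (x :: B) :: L' else [:: [:: x]]).
rewrite (_ : F _ = F' (if s is [::] then [::] else [:: s])); last by case: (s).
rewrite -IH; apply: eq_psum => -[|B [|B' L]] _ /=.
- by rewrite addr0.
- by rewrite add0r scaler0 addr0.
- rewrite !add0r; case: L => [|B'' L] /=; rewrite ?(addr0, add0r, scaler0) //.
  suff ->: isum x L (fun=> 0 : W) = 0 by rewrite !scaler0.
  exact: isum0.
Qed.

Implicit Types S : seq T -> seq T -> W.

Lemma usum_ind (Q : W -> Prop) (Qs : is_subspace Q) s S :
  (forall a b, (size a + size b = size s)%N -> Q (S a b)) -> Q (usum s S).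
Proof.
elim: s S => [|x s IH] S QF /=; first exact: QF.
apply: IH => a b ab; apply: subspaceD => //; first by apply: QF; rewrite /= addSn ab.
by apply: subspaceZ => //; apply: QF; rewrite /= addnS ab.
Qed.

Lemma usumZ s a S : usum s (fun u v => a *: S u v) = a *: usum s S.
Proof.
elim: s S => [|x s IH] S //=; rewrite -IH; congr usum.
apply: boolp.funext => u; apply: boolp.funext => v.
by rewrite scalerDr !scalerA mulrC.
Qed.

Lemma eq_usum s S S' :
  (forall a b, (size a + size b = size s)%N -> S a b = S' a b) -> usum s S = usum s S'.
Proof.
move=> E; apply/eqP; rewrite -subr_eq0 -scaleN1r -usumZ -usumD; apply/eqP.
by apply: (usum_ind subspace0) => a b /E ->; rewrite scaleN1r subrr.
Qed.

Lemma usum_only_l s S :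
  (forall a b, (size a + size b = size s)%N -> (0 < size b)%N -> S a b = 0) ->
  usum s S = S s [::].
Proof.
elim: s S => [|x s IH] S S0 //=.
rewrite IH => [|a b ab b0]; last by rewrite !S0 ?scaler0 ?addr0 //= ?addSn ?addnS ab.
by rewrite (S0 s [:: x]) ?scaler0 ?addr0 //= addn1.
Qed.

Lemma usum_only_r s S :
  (forall a b, (size a + size b = size s)%N -> (0 < size a)%N -> S a b = 0) ->
  usum s S = S [::] s.
Proof.
elim: s S => [|x s IH] S S0 //=.
rewrite IH => [|a b ab b0]; last by rewrite !S0 ?scaler0 ?addr0 //= ?addSn ?addnS ab.
by rewrite (S0 [:: x] s) //= degs_nil sgn2_0r scale1r add0r.
Qed.

End SignedSumsTheory.

(** * Dividing the blocks of a partition into two groups *)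

Section UnshuffleBlocks.
Context {k : fieldType} {T : Type} (deg : T -> int) {W : lmodType k}.
Implicit Types (x y : T) (s t : seq T) (L P Q R : seq (seq T)).
Notation isum := (isum deg).
Notation psum := (psum deg).
Notation bsum := (usum (degs deg)).
Notation eps a b := (sgn2 k a b).

Lemma degs_flatten L : degs (degs deg) L = degs deg (flatten L).
Proof. by elim: L => [|B L IH]; rewrite ?degs_nil //= degs_cons degs_cat IH. Qed.

(** The block that receives [x] ends up in [Q] or in [R], so the blocks may be unshuffled before the
    insertion. If a block [B] of [R] passes over [Q] after [x] has joined [Q], its extra sign with
    [x] cancels the sign of [x] having passed [B]. *)
Lemma isum_bsum x L (F : seq (seq T) -> seq (seq T) -> W) :
  isum x L (fun P => bsum P F) =
  bsum L (fun Q R => isum x Q (fun Q' => F Q' R) +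
    eps (deg x) (degs deg (flatten Q)) *: isum x R (F Q)).
Proof.
elim: L F => [|B L IH] F /=; first by rewrite scaler0 addr0.
rewrite IH -usumZ -usumD; apply: eq_usum => Q R _.
rewrite !degs_flatten /= degs_cons degs_cat !sgn2Dl !sgn2Dr !isumD !isumZ.
have -> : isum x Q (fun P => eps (degs deg B) (degs (degs deg) P) *: F P (B :: R)) =
  (eps (degs deg B) (deg x) * eps (degs deg B) (degs deg (flatten Q))) *:
     isum x Q (fun P => F P (B :: R)).
  rewrite -isumZ; apply: eq_isum => L1 B' L2 ->.
  rewrite degs_flatten -sgn2Dr !flatten_cat /= !degs_cat degs_cons.
  by congr (eps _ _ *: _); rewrite degs_cat; ring.
rewrite !scalerDr !scalerA (sgn2C (degs deg B) (deg x)).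
rewrite !addrA; set e1 := eps _ _; set e2 := eps _ _.
rewrite [_ * (_ * e2)]mulrA sgn2_sqr mul1r (mulrC e2 e1) (mulrC (e1 * e2)) mulrA.
by rewrite [LHS](ACl (1*3*5*4*2*6)).
Qed.

Lemma isum_psum x Q s (F : seq (seq T) -> seq (seq T) -> W) :
  isum x Q (fun P => psum s (F P)) = psum s (fun R => isum x Q (F^~ R)).
Proof.
elim: Q F => [|B Q IH] F /=; first by rewrite psum0.
by rewrite IH -psumZ -psumD.
Qed.

(** This is the compatibility with the unshuffle coproduct that makes the sum over partitions a
    morphism of coalgebras. *)
Lemma psum_bsum s (F : seq (seq T) -> seq (seq T) -> W) :
  psum s (fun P => bsum P F) =
  usum deg s (fun a b => psum a (fun Q => psum b (F Q))).
Proof.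
elim: s F => [|x s IH] F //=.
transitivity (psum s (fun L => bsum L (fun Q R =>
    (F ([:: x] :: Q) R + isum x Q (F^~ R)) +
    eps (deg x) (degs deg (flatten Q)) *: (F Q ([:: x] :: R) + isum x R (F Q))))).
  apply: eq_psum => L _; rewrite isum_bsum -usumD; apply: eq_usum => Q R _.
  by rewrite degs_flatten degs_cons degs_nil addr0 addrACA -scalerDr.
rewrite IH; apply: eq_usum => a b _.
rewrite -[X in _ + X]psumZ -[RHS]psumD.
apply: eq_psum => Q [_ _ dQ]; rewrite isum_psum -psumD -[X in _ + X]psumZ -[RHS]psumD.
by apply: eq_psum => R _; rewrite dQ.
Qed.

End UnshuffleBlocks.

(** * Graded symmetry and linearity of sums over partitions *)

Section SymmetricSums.
Context {k : fieldType} {T : Type} (deg : T -> int) {W : lmodType k}.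
Implicit Types (x y u v : T) (s t l r A B : seq T) (L P Q R : seq (seq T)).
Implicit Types F : seq (seq T) -> W.
Notation isum := (isum deg).
Notation psum := (psum deg).
Notation eps a b := (sgn2 k a b).

Definition sym_in_blocks F := forall L1 L2 l r u v,
  F (L1 ++ (l ++ u :: v :: r) :: L2) =
  eps (deg u) (deg v) *: F (L1 ++ (l ++ v :: u :: r) :: L2).

Definition sym_blocks F := forall L1 L2 A B,
  F (L1 ++ A :: B :: L2) =
  eps (degs deg A) (degs deg B) *: F (L1 ++ B :: A :: L2).

(** One step of the recursion of [psum]. Properties of [psum] deep inside a list reduce to the
    stability of the conditions on the summand under this step. *)
Definition insF x F L := F ([:: x] :: L) + isum x L F.

Lemma degs_swap l r u v : degs deg (l ++ u :: v :: r) = degs deg (l ++ v :: u :: r).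
Proof. by rewrite !degs_cat !degs_cons; congr (_ + _); rewrite addrCA. Qed.

Lemma isum_cat x L1 L2 F : isum x (L1 ++ L2) F =
  isum x L1 (fun P => F (P ++ L2)) +
  eps (deg x) (degs deg (flatten L1)) *: isum x L2 (fun P => F (L1 ++ P)).
Proof.
elim: L1 F => [|B L1 IH] F /=; first by rewrite degs_nil sgn2_0r scale1r add0r.
by rewrite IH degs_cat sgn2Dr scalerDr scalerA addrA.
Qed.

Lemma sym_in_blocks_insF x F : sym_in_blocks F -> sym_in_blocks (insF x F).
Proof.
move=> sF L1 L2 l r u v; rewrite /insF scalerDr; congr (_ + _).
  exact: (sF ([:: x] :: L1)).
rewrite !isum_cat /= !scalerDr; congr (_ + _).
  by rewrite -isumZ; apply: eq_isum.
rewrite (sF L1 L2 (x :: l)) !scalerA mulrC; congr (_ + _).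
rewrite degs_swap -!mulrA [in RHS]mulrC -!scalerA; do 2 congr (_ *: _).
rewrite -isumZ; apply: eq_isum => M1 B M2 _; exact: (sF L1).
Qed.

Lemma sym_blocks_insF x F : sym_blocks F -> sym_blocks (insF x F).
Proof.
move=> sF L1 L2 A B; rewrite /insF scalerDr; congr (_ + _).
  exact: (sF ([:: x] :: L1)).
rewrite !isum_cat /= !scalerDr; congr (_ + _).
  by rewrite -isumZ; apply: eq_isum.
rewrite (sF L1 _ (x :: A)) (sF L1 _ A (x :: B)) !degs_cons !sgn2Dl !sgn2Dr.
have -> : isum x L2 (fun P => F (L1 ++ A :: B :: P)) =
  eps (degs deg A) (degs deg B) *: isum x L2 (fun P => F (L1 ++ B :: A :: P)).
  by rewrite -isumZ; apply: eq_isum => M1 C M2 _; exact: (sF L1).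
rewrite !scalerA.
rewrite addrCA (sgn2C (degs deg A) (deg x)).
set eA := eps (deg x) (degs deg A); set e1 := eps (deg x) (degs deg (flatten L1)).
have eA2 : eA * eA = 1 by exact: sgn2_sqr.
congr (_ *: _ + (_ *: _ + _ *: _)); [|ring|ring].
by rewrite mulrA -(mulrA e1) eA2 mulr1 mulrC.
Qed.

Lemma isum_isum u v L F : sym_in_blocks F ->
  isum v L (fun P => isum u P F) =
  eps (deg u) (deg v) *: isum u L (fun P => isum v P F).
Proof.
elim: L F => [|B L IH] F sF /=; first by rewrite scaler0.
rewrite !isumD !isumZ IH; last by move=> L1 L2; apply: (sF (B :: L1)).
rewrite !scalerDr !scalerA (sF [::] L [::]) /= !degs_cons !sgn2Dr (sgn2C (deg v) (deg u)).
set e := eps (deg u) (deg v); have e2 : e * e = 1 by exact: sgn2_sqr.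
rewrite -!addrA; congr (_ + _); rewrite addrCA.
congr (_ *: _ + (_ *: _ + _ *: _)); last ring.
  by rewrite mulrA e2 mul1r.
Qed.

(** Once the pair is at the head, there are four kinds of terms. Two new singletons are swapped by
    [sym_blocks], and the new block [[:: u; v]] by [sym_in_blocks]. The terms where one letter is
    alone and the other joins an old block are exchanged with each other, and those where both join
    old blocks are covered by [isum_isum]. *)
Lemma sym_psum l r u v F : sym_in_blocks F -> sym_blocks F ->
  psum (l ++ u :: v :: r) F = eps (deg u) (deg v) *: psum (l ++ v :: u :: r) F.
Proof.
elim: l F => [|x l IH] F sF bF /=; last first.
  by apply: IH; [apply: sym_in_blocks_insF | apply: sym_blocks_insF].
rewrite -psumZ; apply: eq_psum => L _.
rewrite !isumD (isum_isum u v L sF) !scalerDr !degs_cons !degs_nil !addr0 !scalerA.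
rewrite (bF [::] L [:: u] [:: v]) (sF [::] L [::] [::] u v) /= !degs_cons !degs_nil !addr0.
rewrite (sgn2C (deg v) (deg u)) sgn2_sqr scale1r -!addrA; congr (_ + (_ + _)).
by rewrite addrCA.
Qed.

(** The letters form a mere type, so linearity is expressed along a map [e] from a vector space,
    such as [pair d]. The lemmas ask that [e] have constant degree, which keeps the signs
    independent of the vector. *)
Definition linear_slot (V : lmodType k) (e : V -> T) F :=
  forall L1 L2 l r, linear_map (fun w => F (L1 ++ (l ++ e w :: r) :: L2)).

Lemma linear_slot_isum (V : lmodType k) (e : V -> T) (d : int) L F :
  (forall w, deg (e w) = d) -> linear_slot e F ->
  linear_map (fun w => isum (e w) L F).
Proof.
move=> de eF a u v; elim: L F eF => [|B L IH] F eF /=; first by rewrite scaler0 addr0.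
rewrite (eF [::] L [::] B) IH; last by move=> L1 L2; apply: (eF (B :: L1)).
by rewrite !de !scalerDr !scalerA (mulrC a) addrACA.
Qed.

Lemma linear_slot_insF (V : lmodType k) (e : V -> T) (d : int) x F :
  (forall w, deg (e w) = d) -> linear_slot e F -> linear_slot e (insF x F).
Proof.
move=> de eF L1 L2 l r a u v; rewrite /insF scalerDr addrACA; congr (_ + _).
  exact: (eF ([:: x] :: L1)).
have dS w : degs deg (l ++ e w :: r) = degs deg (l ++ e 0 :: r).
  by rewrite !degs_cat !degs_cons !de.
rewrite !isum_cat /= !dS (eF L1 L2 (x :: l)).
have -> : isum x L1 (fun P => F (P ++ (l ++ e (a *: u + v) :: r) :: L2)) =
    a *: isum x L1 (fun P => F (P ++ (l ++ e u :: r) :: L2)) +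
    isum x L1 (fun P => F (P ++ (l ++ e v :: r) :: L2)).
  by rewrite -isumZ -isumD; apply: eq_isum => *; apply: eF.
have -> : isum x L2 (fun P => F (L1 ++ (l ++ e (a *: u + v) :: r) :: P)) =
    a *: isum x L2 (fun P => F (L1 ++ (l ++ e u :: r) :: P)) +
    isum x L2 (fun P => F (L1 ++ (l ++ e v :: r) :: P)).
  by rewrite -isumZ -isumD; apply: eq_isum => *; apply: eF.
rewrite !scalerDr !scalerA !addrA [LHS](ACl (1*3*5*2*4*6)) /=.
by congr (_ + _ *: _ + _ *: _ + _ + _ + _); ring.
Qed.

Lemma linear_slot_psum (V : lmodType k) (e : V -> T) (d : int) l r F :
  (forall w, deg (e w) = d) -> linear_slot e F ->
  linear_map (fun w => psum (l ++ e w :: r) F).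
Proof.
move=> de; elim: l F => [|x l IH] F eF /=; last by apply: IH; apply: linear_slot_insF eF.
move=> a u v; rewrite -psumZ -psumD; apply: eq_psum => L _.
rewrite scalerDr addrACA; congr (_ + _); first exact: (eF [::] L [::] [::]).
exact: (linear_slot_isum _ de).
Qed.

End SymmetricSums.

(** * Change of letters in a signed sum *)

Section Relabelling.
Context {k : fieldType} {T T' : Type} (deg : T -> int) (deg' : T' -> int) {W : lmodType k}.
Variables (f : T -> T') (df : forall x, deg' (f x) = deg x).

Lemma degs_map s : degs deg' (map f s) = degs deg s.
Proof. by elim: s => [|x s IH]; rewrite ?degs_nil //= !degs_cons df IH. Qed.

Lemma isum_map x L (F : _ -> W) :
  isum deg' (f x) (map (map f) L) F = isum deg x L (fun P => F (map (map f) P)).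
Proof. by elim: L F => [|B L IH] F //=; rewrite df degs_map IH. Qed.

Lemma psum_map s (F : _ -> W) :
  psum deg' (map f s) F = psum deg s (fun P => F (map (map f) P)).
Proof.
elim: s F => [|x s IH] F //=; rewrite IH; apply: eq_psum => L _.
by rewrite isum_map.
Qed.

End Relabelling.

(** * Partitions of [enum 'I_n] as lists of blocks *)

Section PartitionLists.
Context {n : nat}.
Implicit Types (x : 'I_n) (s t B : seq 'I_n) (L M : seq (seq 'I_n)).

Fixpoint add_head x L : seq (seq (seq 'I_n)) :=
  if L is B :: L' then ((x :: B) :: L') :: map (cons B) (add_head x L') else [::].

Definition add_min x L := ([:: x] :: L) :: add_head x L.

Fixpoint parts s : seq (seq (seq 'I_n)) :=
  if s is x :: s' then flatten (map (add_min x) (parts s')) else [:: [::]].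

Definition ltI : rel 'I_n := fun i j => (i < j)%N.

Definition maxl B : nat := \max_(i <- B) (i : nat).

(** Describes the lists that come from set partitions. The weak order on maxima is enough: when [s]
    has no repetition, distinct blocks have distinct maxima. *)
Definition ordered_partition s L :=
  [&& perm_eq (flatten L) s, all (fun B => B != [::]) L, all (sorted ltI) L
    & sorted leq (map maxl L)].

Lemma ltI_trans : transitive ltI. Proof. by move=> j i l; apply: ltn_trans. Qed.
Lemma ltI_irr : irreflexive ltI. Proof. by move=> i; apply: ltnn. Qed.

Lemma add_headP x L M :
  reflect (exists L1 B L2, L = L1 ++ B :: L2 /\ M = L1 ++ (x :: B) :: L2)
          (M \in add_head x L).
Proof.
elim: L M => [|B L IH] M /=.
  by apply: (iffP idP) => // -[[|? ?] [? [? []]]].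
rewrite inE; apply: (iffP orP) => [[/eqP->|/mapP[M' /IH[L1 [B' [L2 [-> ->]]]] ->]]|].
- by exists [::], B, L.
- by exists (B :: L1), B', L2.
case=> -[|B1 L1] [B' [L2 [/= [-> eL] ->]]]; [by left; rewrite eL | right].
by apply: map_f; apply/IH; exists L1, B', L2.
Qed.

Lemma perm_add_min x L M : M \in add_min x L -> perm_eq (flatten M) (x :: flatten L).
Proof.
rewrite inE => /predU1P[->|/add_headP[L1 [B [L2 [-> ->]]]]] //=.
by rewrite !flatten_cat /= -cat1s perm_catCA.
Qed.

(** A left inverse of the insertions of [x]: it recovers the partition from which an entry of
    [parts] was built, so different partitions of the tail yield different entries. *)
Definition drop_elt x M := [seq B <- map (filter (predC1 x)) M | B != [::]].

Lemma drop_elt_id x L : all (fun B => B != [::]) L -> x \notin flatten L ->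
  drop_elt x L = L.
Proof.
rewrite /drop_elt; elim: L => //= B L IH /andP[B0 L0].
rewrite mem_cat negb_or => /andP[xB xL].
rewrite (_ : [seq _ <- B | _] = B) ?B0 ?IH //.
by apply/all_filterP/allP => y yB /=; apply: contraNneq xB => <-.
Qed.

Lemma drop_eltK x L M : all (fun B => B != [::]) L -> x \notin flatten L ->
  M \in add_min x L -> drop_elt x M = L.
Proof.
move=> L0 xL; rewrite inE => /predU1P[->|].
  by rewrite /drop_elt /= eqxx /=; apply: drop_elt_id.
case/add_headP=> L1 [B [L2 [eL ->]]].
rewrite -[RHS](drop_elt_id L0 xL) eL /drop_elt !map_cat /= eqxx //.
Qed.

Lemma uniq_add_head x L : uniq (add_head x L).
Proof.
elim: L => //= B L IH; rewrite map_inj_uniq ?IH ?andbT; last by move=> ? ? [].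
apply/mapP => -[M _ [eB _]].
by have := congr1 size eB => /=; lia.
Qed.

Lemma uniq_add_min x L : uniq (add_min x L).
Proof.
rewrite /= uniq_add_head andbT; apply/add_headP => -[L1 [B [L2 [-> eM]]]].
by have := congr1 size eM; rewrite /= !size_cat /=; lia.
Qed.

Lemma uniq_flatten_map (X Y : eqType) (f : X -> seq Y) (g : Y -> X) (r : seq X) :
  uniq r -> (forall z, z \in r -> uniq (f z)) ->
  (forall z y, z \in r -> y \in f z -> g y = z) -> uniq (flatten (map f r)).
Proof.
elim: r => //= z r IH /andP[zr ur] uf fg; rewrite cat_uniq uf ?mem_head //=.
rewrite IH // => [|z' z'r|z' y z'r]; last 2 first.
- by apply: uf; rewrite inE z'r orbT.
- by apply: fg; rewrite inE z'r orbT.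
rewrite andbT; apply/hasPn => y /flatten_mapP[z' z'r yz'].
apply/negP => /fg e1; move: zr; rewrite -e1 ?mem_head // (fg z') ?z'r //.
by rewrite inE z'r orbT.
Qed.

Lemma maxl_cons x B : maxl (x :: B) = maxn x (maxl B).
Proof. exact: big_cons. Qed.

Lemma maxl_ltn x B : B != [::] -> all (ltI x) B -> (x < maxl B)%N.
Proof. by case: B => //= y B _ /andP[xy _]; rewrite maxl_cons leq_max [(x < y)%N]xy. Qed.

Lemma parts_ordered s L : sorted ltI s -> L \in parts s -> ordered_partition s L.
Proof.
elim: s L => [|x s IH] L; first by rewrite inE => _ /eqP->.
move=> sxs; have xs : all (ltI x) s by apply: order_path_min sxs; exact: ltI_trans.
move=> /= /flatten_mapP[L' /(IH _ (path_sorted sxs)) /and4P[pL' nL' sL' mL'] LL'].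
have xL' : all (ltI x) (flatten L') by rewrite (perm_all _ pL').
apply/and4P; split.
- by rewrite (permPl (perm_add_min LL')) perm_cons.
- case/predU1P: LL' => [->|/add_headP[L1 [B [L2 [eL ->]]]]] //=.
  by move: nL'; rewrite eL !all_cat /= => /and3P[-> _ ->].
- case/predU1P: LL' => [->|/add_headP[L1 [B [L2 [eL ->]]]]] //=.
  move: sL' xL'; rewrite eL flatten_cat /= !all_cat /= => /and3P[-> sB ->] /and3P[_ xB _].
  by rewrite andbT /= (path_sortedE ltI_trans) xB.
- case/predU1P: LL' => [->|/add_headP[L1 [B [L2 [eL ->]]]]] /=.
    case: (L') nL' xL' mL' => //= B L'' /andP[B0 _]; rewrite all_cat => /andP[xB _] ->.
    by rewrite andbT maxl_cons /maxl big_nil maxn0 ltnW // maxl_ltn.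
  move: mL' nL' xL'; rewrite eL flatten_cat /= !all_cat !map_cat /= => mL' /and3P[_ B0 _] /and3P[_ xB _].
  by rewrite maxl_cons (maxn_idPr _) // ltnW // maxl_ltn.
Qed.

(** The least letter [x] heads its block, since blocks are increasing. Deleting it keeps the maximum
    of that block unless the block was [[:: x]], which must then come first. *)
Lemma ordered_parts s L : sorted ltI s -> ordered_partition s L -> L \in parts s.
Proof.
elim: s L => [|x s IH] L sxs /and4P[pL nL sL mL].
  by move: pL nL => /perm_nilP; case: L {sL mL} => //= -[|? ?] L.
have xs : all (ltI x) s by apply: order_path_min sxs; exact: ltI_trans.
have xL B y : B \in L -> y \in B -> (x <= y)%N.
  move=> BL yB; have : y \in flatten L by apply/flattenP; exists B.
  rewrite (perm_mem pL) inE => /predU1P[->//|ys].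
  by apply: ltnW; apply: (allP xs).
have : x \in flatten L by rewrite (perm_mem pL) mem_head.
case/flattenP => B BL xB; case/splitPr: BL pL nL sL mL xL => L1 L2.
rewrite !all_cat /= => pL /and3P[nL1 _ nL2] /and3P[sL1 sB sL2] mL xL.
case: B xB sB pL mL xL => // y B xyB sB pL mL xL.
have {xyB}exy : x = y.
  move: xyB; rewrite inE => /predU1P[//|xB].
  have : ltI y x by apply: (allP (order_path_min ltI_trans sB)).
  rewrite /ltI ltnNge (xL (y :: B)) ?mem_head //.
  by rewrite mem_cat mem_head orbT.
subst y.
have pLs : perm_eq (flatten (L1 ++ B :: L2)) s.
  rewrite -(perm_cons x) -(permPr pL) !flatten_cat /=.
  by rewrite -cat1s -[x :: (B ++ _)]cat1s perm_catCA.
have xB : all (ltI x) B by move: sB; rewrite /= (path_sortedE ltI_trans) => /andP[].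
have sB' : sorted ltI B by apply: path_sorted sB.
have ss : sorted ltI s by apply: path_sorted sxs.
have xNs : x \notin s by apply/negP => /(allP xs); rewrite /ltI ltnn.
have mB : maxl (x :: B) = if B == [::] then val x else maxl B.
  rewrite maxl_cons; case: eqP => [->|/eqP B0]; first by rewrite /maxl big_nil maxn0.
  by rewrite (maxn_idPr _) // ltnW // maxl_ltn.
case: (eqVneq B [::]) => [eB|B0]; last first.
  apply/flatten_mapP; exists (L1 ++ B :: L2); last first.
    by rewrite inE; apply/orP; right; apply/add_headP; exists L1, B, L2.
  apply: IH => //; apply/and4P; split; rewrite ?all_cat /= ?nL1 ?B0 ?sL1 ?sB' //.
  by move: mL; rewrite !map_cat /= mB (negPf B0).
(* [x] is the least element, so the blocks before [:: x] have maximum x. *)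
have L10 : L1 = [::].
  case: L1 nL1 mL xL pLs {pL sL1} => // A L1 /= /andP[A0 _] mL xL pLs.
  have /= := order_path_min leq_trans mL; rewrite map_cat all_cat /= mB eB eqxx.
  case/and3P => _ Ax _; case: A A0 Ax xL pLs {mL} => // y A _ Ax xL pLs.
  have xy : (x <= y)%N by apply: (xL (y :: A)); rewrite mem_head.
  have yx : (y <= x)%N by apply: leq_trans Ax; rewrite maxl_cons leq_maxl.
  have exy : x = y by apply: val_inj; apply/eqP; rewrite eqn_leq xy.
  by move: xNs; rewrite -(perm_mem pLs) exy mem_head.
rewrite eB L10 /= in pLs mL *; apply/flatten_mapP; exists L2; last exact: mem_head.
by apply: IH => //; apply/and4P; split => //; apply: path_sorted mL.
Qed.

Lemma mem_parts s L : sorted ltI s -> (L \in parts s) = ordered_partition s L.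
Proof. by move=> ss; apply/idP/idP; [apply: parts_ordered | apply: ordered_parts]. Qed.

Lemma uniq_parts s : sorted ltI s -> uniq (parts s).
Proof.
elim: s => // x s IH sxs; have ss := path_sorted sxs.
have xNs : x \notin s.
  by apply/negP => /(allP (order_path_min ltI_trans sxs)); rewrite /ltI ltnn.
apply: (@uniq_flatten_map _ _ _ (drop_elt x)) => [|L _|L M]; first exact: IH.
  exact: uniq_add_min.
rewrite mem_parts // => /and4P[pL nL _ _]; apply: drop_eltK => //.
by rewrite (perm_mem pL).
Qed.

Lemma sorted_enum_ord (B : pred 'I_n) : sorted ltI (enum B).
Proof.
rewrite /enum_mem -enumT; apply: sorted_filter; first exact: ltI_trans.
by have := iota_ltn_sorted 0 n; rewrite -val_enum_ord sorted_map.
Qed.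

Definition block_lists (P : {set {set 'I_n}}) : seq (seq 'I_n) :=
  [seq enum B | B : {set 'I_n} <- blocks P].

Lemma maxl_enum (B : {set 'I_n}) : maxl (enum B) = bmax B.
Proof. by rewrite /maxl big_enum. Qed.

Lemma enum_set_inj : injective (fun B : {set 'I_n} => enum B).
Proof. by move=> A B eAB; apply/setP => i; rewrite -(mem_enum A) eAB mem_enum. Qed.

Lemma perm_blocks (P : {set {set 'I_n}}) : perm_eq (blocks P) (enum P).
Proof. by rewrite /blocks perm_sort. Qed.

Lemma mem_blocks (P : {set {set 'I_n}}) : blocks P =i P.
Proof. by move=> B; rewrite (perm_mem (perm_blocks P)) mem_enum. Qed.

Lemma block_lists_inj : injective block_lists.
Proof.
move=> P Q /(inj_map enum_set_inj) ePQ; apply/setP => B.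
by rewrite -(mem_blocks P) ePQ mem_blocks.
Qed.

Lemma sorted_blocks (P : {set {set 'I_n}}) : sorted leq (map maxl (block_lists P)).
Proof.
rewrite -map_comp (eq_map (g := @bmax n)); last by move=> B; apply: maxl_enum.
rewrite sorted_map; apply: sort_sorted => A B; exact: leq_total.
Qed.

Lemma block_lists_ordered (P : {set {set 'I_n}}) :
  partition P [set: 'I_n] -> ordered_partition (enum 'I_n) (block_lists P).
Proof.
case/and3P => /eqP cP tP P0; apply/and4P; split.
- apply: uniq_perm; rewrite ?enum_uniq //.
    rewrite (@uniq_flatten_map _ _ (fun B : {set 'I_n} => enum B) (pblock P)) //.
    + by rewrite (perm_uniq (perm_blocks P)) enum_uniq.
    + by move=> *; apply: enum_uniq.
    + by move=> B i; rewrite mem_blocks mem_enum => BP iB; rewrite (def_pblock tP BP iB).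
  move=> i; rewrite mem_enum; apply/flatten_mapP.
  have : i \in cover P by rewrite cP inE.
  by case/bigcupP => B BP iB; exists B; rewrite ?mem_blocks ?mem_enum.
- apply/allP => _ /mapP[B BP ->]; rewrite mem_blocks in BP.
  apply/negP => /eqP eB; move/negP: P0; apply.
  rewrite (_ : set0 = B) //; apply/setP => i.
  by rewrite inE -mem_enum eB.
- by apply/allP => _ /mapP[B BP ->]; apply: sorted_enum_ord.
- exact: sorted_blocks.
Qed.

Lemma ordered_block_lists L : ordered_partition (enum 'I_n) L ->
  exists2 P, partition P [set: 'I_n] & block_lists P = L.
Proof.
case/and4P => pL nL sL mL.
have uL : uniq (flatten L) by rewrite (perm_uniq pL) enum_uniq.
pose S := [seq [set i in B] | B <- L]; pose P := [set A in S].
have eS : [seq enum A | A : {set 'I_n} <- S] = L.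
  rewrite -map_comp -[RHS]map_id; apply/eq_in_map => B BL /=.
  apply: (irr_sorted_eq ltI_trans ltI_irr (sorted_enum_ord _) (allP sL _ BL)).
  by move=> i; rewrite mem_enum inE.
have tL A B i : A \in L -> B \in L -> i \in A -> i \in B -> A = B.
  elim: (L) uL => //= B' L' IH; rewrite cat_uniq => /and3P[_ /hasPn dB uL'].
  have dL A' : A' \in L' -> i \in A' -> i \in B' -> False.
    move=> A'L iA' iB'; have /dB/negP : i \in flatten L' by apply/flattenP; exists A'.
    exact.
  rewrite !inE => /predU1P[->|AL] /predU1P[->|BL] // iA iB; last exact: IH.
    by case: (dL _ BL).
  by case: (dL _ AL).
have nN : [::] \notin L by apply/negP => /(allP nL).
have uniqL : uniq L.
  elim: (L) nL uL => //= B' L' IH /andP[B0 nL']; rewrite cat_uniq => /and3P[_ /hasPn dB uL'].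
  rewrite IH // andbT; apply/negP => B'L; case: B' B0 dB B'L => // i B' _ dB B'L.
  have /dB/negP : i \in flatten L' by apply/flattenP; exists (i :: B'); rewrite ?mem_head.
  by apply; rewrite mem_head.
have uS : uniq S by apply: (@map_uniq _ _ (fun A : {set 'I_n} => enum A)); rewrite eS.
exists P.
  apply/and3P; split.
  - apply/eqP/setP => i; rewrite inE; apply/bigcupP.
    have /flattenP[B BL iB] : i \in flatten L by rewrite (perm_mem pL) mem_enum.
    by exists [set i in B]; rewrite inE // map_f.
  - apply/trivIsetP => A B; rewrite !inE => /mapP[A' A'L ->] /mapP[B' B'L ->] AB.
    rewrite -setI_eq0; apply: contraNT AB => /set0Pn[i]; rewrite !inE => /andP[iA iB].
    by rewrite (tL A' B' i).
  - rewrite inE; apply/negP => /mapP[B BL e0].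
    have := allP nL _ BL; case: B e0 BL => // i B /setP/(_ i).
    by rewrite !inE eqxx.
rewrite /block_lists -eS; congr map.
have mS : map (@bmax n) S = map maxl L.
  transitivity (map maxl [seq enum A | A : {set 'I_n} <- S]); last by rewrite eS.
  by rewrite -[RHS]map_comp; apply/eq_in_map => B _ /=; rewrite maxl_enum.
have pS : perm_eq (blocks P) S.
  apply: uniq_perm; rewrite // ?(perm_uniq (perm_blocks P)) ?enum_uniq // => A.
  by rewrite mem_blocks inE.
apply: (@sorted_eq_in _ (fun A B : {set 'I_n} => (bmax A <= bmax B)%N)) => //.
- by move=> A B D _ _ _; apply: leq_trans.
(* Antisymmetry, which makes the sorted order unique: a block contains its maximum, so blocks with
   equal maxima meet and hence coincide. *)
- move=> A B; rewrite !mem_blocks !inE => /mapP[A' A'L ->] /mapP[B' B'L ->].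
  rewrite -eqn_leq => /eqP eAB.
  have maxI D : D \in L -> exists2 i, i \in D & bmax [set i in D] = val i.
    move=> DL; have D0 := allP nL _ DL; case: D D0 DL => // i D _ _.
    have c0 : (0 < #|[set j in i :: D]|)%N by apply/card_gt0P; exists i; rewrite !inE eqxx.
    by case: (eq_bigmax_cond val c0) => j; rewrite inE => jD ej; exists j.
  have [a aA ea] := maxI _ A'L; have [b bB eb] := maxI _ B'L.
  have ab : a = b by apply: val_inj; rewrite -ea -eb.
  by rewrite (tL A' B' a) // ab.
- by apply: sort_sorted => A B; apply: leq_total.
- by have := mL; rewrite -mS sorted_map.
Qed.

Lemma sum_block_lists (W : nmodType) (G : seq (seq 'I_n) -> W) :
  \sum_(P : {set {set 'I_n}} | partition P [set: 'I_n]) G (block_lists P) =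
  \sum_(L <- parts (enum 'I_n)) G L.
Proof.
rewrite -big_filter -(big_map block_lists predT G).
apply: perm_big; apply: uniq_perm.
- by rewrite (map_inj_uniq block_lists_inj) filter_uniq // index_enum_uniq.
- exact/uniq_parts/sorted_enum_ord.
move=> L; rewrite mem_parts; last exact: sorted_enum_ord.
apply/mapP/idP => [[P]|].
  by rewrite mem_filter => /andP[PP _] ->; apply: block_lists_ordered.
by case/ordered_block_lists => P PP <-; exists P; rewrite // mem_filter PP mem_index_enum.
Qed.

End PartitionLists.

(** * Koszul signs of ordered partitions *)

Section KoszulSums.
Context {k : fieldType} {n : nat} (ds : 'I_n -> int) {W : lmodType k}.
Implicit Types (x : 'I_n) (s t B : seq 'I_n) (L M : seq (seq 'I_n)).

Definition cross s t : k :=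
  \prod_(a <- s) \prod_(b <- t | (b < a)%N) sgn2 k (ds a) (ds b).

Lemma kz_cat s t : kz k ds (s ++ t) = kz k ds s * cross s t * kz k ds t.
Proof.
elim: s => [|a s IH] /=; first by rewrite /cross big_nil !mul1r.
rewrite IH big_cat /= /cross big_cons; ring.
Qed.

Lemma kz_min x s : all (ltI x) s -> kz k ds (x :: s) = kz k ds s.
Proof.
move=> /allP xs /=; rewrite big_seq_cond big1 ?mul1r // => b /andP[/xs xb bx].
by have := ltn_trans xb bx; rewrite ltnn.
Qed.

Lemma cross_min x s t : all (ltI x) s -> cross s (x :: t) = sgn2 k (ds x) (degs ds s) * cross s t.
Proof.
rewrite /cross; elim: s => [|a s IH]; first by rewrite !big_nil degs_nil sgn2_0r mul1r.
move=> /= /andP[xa xs]; rewrite !big_cons IH // [(x < a)%N]xa degs_cons sgn2Dr.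
rewrite (sgn2C (ds a)); ring.
Qed.

Lemma perm_cross s t t' : perm_eq t t' -> cross s t = cross s t'.
Proof. by move=> tt'; apply: eq_bigr => a _; apply: perm_big. Qed.

(** Since [x] is least, the inversions it creates are exactly those with the letters of the blocks
    before its own, and these make up the sign in [isum]. *)
Lemma sum_add_head x L (F : _ -> W) : all (ltI x) (flatten L) ->
  \sum_(M <- add_head x L) kz k ds (flatten M) *: F M =
  kz k ds (flatten L) *: isum ds x L F.
Proof.
elim: L F => [|B L IH] F /=; first by rewrite big_nil scaler0.
rewrite all_cat => /andP[xB xL]; rewrite big_cons big_map scalerDr; congr (_ + _).
  by rewrite (@kz_min x (B ++ flatten L)) // all_cat xB.
rewrite (eq_big_seq (fun M => (kz k ds B * (sgn2 k (ds x) (degs ds B) * cross B (flatten L))) *: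
   (kz k ds (flatten M) *: F (B :: M)))) => [|M ML].
  rewrite -scaler_sumr (IH (fun M => F (B :: M))) // !scalerA kz_cat.
  by congr (_ *: _); ring.
rewrite [flatten (B :: M)]/= kz_cat (perm_cross _ (t' := x :: flatten L)) ?cross_min ?scalerA //.
by apply: perm_add_min; rewrite inE ML orbT.
Qed.

Lemma psum_parts s (F : _ -> W) : sorted ltI s ->
  psum ds s F = \sum_(L <- parts s) kz k ds (flatten L) *: F L.
Proof.
elim: s F => [|x s IH] F sxs /=; first by rewrite big_seq1 scale1r.
have ss := path_sorted sxs; have xs := order_path_min ltI_trans sxs.
rewrite IH // big_flatten /= big_map; apply: eq_big_seq => L.
rewrite mem_parts // => /and4P[pL _ _ _].
have xL : all (ltI x) (flatten L) by rewrite (perm_all _ pL).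
by rewrite big_cons sum_add_head // scalerDr (@kz_min x (flatten L)).
Qed.

(** The bridge between sums over set partitions, with their Koszul signs, and the recursive sums. *)
Lemma sum_partitions (G : _ -> W) :
  \sum_(P : {set {set 'I_n}} | partition P [set: 'I_n]) epsP k ds P *: G (block_lists P) =
  psum ds (enum 'I_n) G.
Proof.
rewrite psum_parts ?sorted_enum_ord //.
exact: (sum_block_lists (fun L => kz k ds (flatten L) *: G L)).
Qed.

End KoszulSums.

(** * Sums with one distinguished block *)

Section OneOperation.
Context {k : fieldType} {T : Type} (deg : T -> int) {V W : lmodType k} (xv : T -> V).
Implicit Types (x : T) (s t a b B : seq T) (L P : seq (seq T)).
Implicit Types (d : int) (g : seq T -> V) (F : seq V -> W).

Definition single B := size B == 1%N.

(* The sum over the choices of a block [B] of [L] such that all other blocks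
   are singletons; [B] is replaced by [g B], where the operation [g] of degree
   [d] passes over the preceding blocks. *)
Fixpoint osum d g L F : W :=
  if L is B :: L' then
    (if all single L' then F (g B :: map xv (flatten L')) else 0) +
    (if B is [:: b] then sgn2 k d (deg b) *: osum d g L' (fun w => F (xv b :: w)) else 0)
  else 0.

Lemma osum_ind (Q : W -> Prop) (Qs : is_subspace Q) d g L F :
  (forall L1 B L2, L = L1 ++ B :: L2 -> all single L1 -> all single L2 ->
     Q (F (map xv (flatten L1) ++ g B :: map xv (flatten L2)))) ->
  Q (osum d g L F).
Proof.
elim: L F => [|B L IH] F QF /=; first exact: Qs.1.
apply: (subspaceD Qs).
  by case: ifP => sL; [apply: (QF [::]) | apply: Qs.1].
case: B QF => [|b [|b' B]] QF; try exact: Qs.1.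
apply: (subspaceZ Qs); apply: IH => L1 B L2 eL sL1 sL2.
by apply: (QF ([:: b] :: L1)); rewrite ?eL.
Qed.

Lemma all_single_insert x L1 B L2 : nonnil B ->
  all single (L1 ++ (x :: B) :: L2) = false.
Proof. by case: B => // y B _; rewrite all_cat /= andbF. Qed.

Lemma nonnil_cat L1 B L2 : all nonnil (L1 ++ B :: L2) -> nonnil B.
Proof. by rewrite all_cat /= => /and3P[]. Qed.

(** A non-distinguished block enlarged by [x] would no longer be a singleton, so [x] joins the
    distinguished block. There it passes the preceding letters together with [g], which raises the
    degree of the operation to [d + deg x]. *)
Lemma isum_osum x d g L F : all nonnil L ->
  isum deg x L (fun P => osum d g P F) = osum (d + deg x) (fun a => g (x :: a)) L F.
Proof.
elim: L F => [|B L IH] F //= /andP[B0 nL]; congr (_ + _).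
  by case: B B0 => //= y B _; rewrite addr0.
transitivity (sgn2 k (deg x) (degs deg B) *: isum deg x L (fun P =>
   if B is [:: b] then sgn2 k d (deg b) *: osum d g P (fun w => F (xv b :: w)) else 0)).
  congr (_ *: _); apply: eq_isum => L1 B' L2 eL.
  by rewrite all_single_insert ?add0r //; apply: (@nonnil_cat L1 B' L2); rewrite -eL.
case: B {B0} => [|b [|b' B]]; rewrite ?isum0 ?scaler0 //.
by rewrite isumZ IH // scalerA degs_cons degs_nil addr0 sgn2Dl mulrC.
Qed.

Lemma nonnil_blocks s L : blocks_of deg s L -> all nonnil L.
Proof. by case. Qed.

Lemma psum_singles s (G : seq T -> W) :
  psum deg s (fun L => if all single L then G (flatten L) else 0) = G s.
Proof.
elim: s G => [|x s IH] G //=; rewrite -(IH (fun t => G (x :: t))).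
apply: eq_psum => L /nonnil_blocks nL /=.
rewrite (_ : isum _ _ _ _ = isum deg x L (fun=> 0 : W)); first by rewrite isum0 addr0.
apply: eq_isum => L1 B L2 eL.
by rewrite all_single_insert //; apply: (@nonnil_cat L1 B L2); rewrite -eL.
Qed.

Definition moves_left d g F := forall l x a r, nonnil a ->
  F (l ++ xv x :: g a :: r) =
  sgn2 k (deg x) (degs deg a + d) *: F (l ++ g a :: xv x :: r).

(** The value of [g] is carried to the front by [moves_left]. The other blocks are singletons in
    increasing order, so a partition with a distinguished block becomes an unshuffle. *)
Lemma psum_osum s d g F : moves_left d g F ->
  psum deg s (fun L => osum d g L F) =
  usum deg s (fun a b => if nonnil a then F (g a :: map xv b) else 0).
Proof.
elim: s d g F => [|x s IH] d g F mF //=.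
transitivity (psum deg s (fun L =>
    (if all single L then F (g [:: x] :: map xv (flatten L)) else 0) +
    (sgn2 k d (deg x) *: osum d g L (fun w => F (xv x :: w)) +
     osum (d + deg x) (fun a => g (x :: a)) L F))).
  by apply: eq_psum => L /nonnil_blocks nL; rewrite isum_osum // addrA.
rewrite !psumD psumZ (psum_singles s (fun t => F (g [:: x] :: map xv t))).
rewrite !IH; last 2 first.
- move=> l y a r _; rewrite (mF l y (x :: a) r) // degs_cons.
  by congr (sgn2 _ _ _ *: _); ring.
- by move=> l y a r a0; apply: (mF (xv x :: l)).
(* The distinguished block [[:: x]] corresponds to an empty left part of the tail, which the
   induction hypothesis leaves out. *)
have -> : F (g [:: x] :: map xv s) =
    usum deg s (fun a b => if nonnil a then 0 else F (g (x :: a) :: map xv b)).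
  by rewrite usum_only_r // => a b _; rewrite lt0n => a0; rewrite /nonnil a0.
rewrite -usumZ addrCA addrC -!usumD; apply: eq_usum => a b _.
congr (_ + _); first by case: ifP => _; rewrite ?addr0 ?add0r.
case: ifP => a0; last by rewrite !scaler0.
rewrite (mF [::]) //= scalerA sgn2Dr mulrCA (sgn2C d) sgn2_sqr.
by rewrite mulr1.
Qed.

End OneOperation.

(** * The sums of the definitions as sums over lists *)

Section FrozenSum.
Context {k : fieldType} {n : nat} (ds : 'I_n -> int) {V W : lmodType k}.
Variables (x : 'I_n -> V) (g : seq V -> V).
Implicit Types (L : seq (seq 'I_n)) (F : seq V -> W).

Definition single_but L i :=
  all (fun j => (j == i) || (size (nth [::] L j) == 1%N)) (iota 0 (size L)).

Definition ins_list L i : seq V :=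
  flatten [seq (if j == i then [:: g (map x (nth [::] L j))] else map x (nth [::] L j))
          | j <- iota 0 (size L)].

Lemma iota1 m : iota 1 m = map S (iota 0 m).
Proof. by rewrite -[1%N]addn0 iotaDl; apply: eq_map. Qed.

Lemma map_nth_iota (X Y : Type) (x0 : X) (f : X -> Y) (s : seq X) :
  [seq f (nth x0 s j) | j <- iota 0 (size s)] = map f s.
Proof. by rewrite -[in RHS](mkseq_nth x0 s) /mkseq -map_comp. Qed.

Lemma single_but0 B L : single_but (B :: L) 0 = all (@single _) L.
Proof.
rewrite /single_but /= iota1 all_map -[in RHS](mkseq_nth [::] L) /mkseq all_map.
by apply: eq_all.
Qed.

Lemma single_butS B L i : single_but (B :: L) i.+1 = (size B == 1%N) && single_but L i.
Proof. by rewrite /single_but /= iota1 all_map; congr (_ && _); apply: eq_all. Qed.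

Lemma ins_list0 B L : ins_list (B :: L) 0 = g (map x B) :: map x (flatten L).
Proof.
rewrite /ins_list /= iota1 -map_comp map_flatten; congr (_ :: flatten _).
exact: (map_nth_iota [::] (map x)).
Qed.

Lemma ins_listS B L i : ins_list (B :: L) i.+1 = map x B ++ ins_list L i.
Proof. by rewrite /ins_list /= iota1 -map_comp. Qed.

Lemma sum_osum d L F :
  \sum_(i <- iota 0 (size L) | single_but L i)
     sgn2 k d (\sum_(j < i) degs ds (nth [::] L j)) *: F (ins_list L i) =
  osum ds x d (fun a => g (map x a)) L F.
Proof.
elim: L F => [|B L IH] F; first by rewrite big_nil.
rewrite [iota _ _]/= big_cons iota1 big_map single_but0 ins_list0 big_ord0 sgn2_0r scale1r.
rewrite [RHS]/=.
rewrite (_ : (if all (@single _) L then _ else _) =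
   (if all (@single _) L then F (g (map x B) :: map x (flatten L)) else 0) +
   \sum_(i <- iota 0 (size L) | single_but (B :: L) i.+1)
     sgn2 k d (\sum_(j < i.+1) degs ds (nth [::] (B :: L) j)) *: F (ins_list (B :: L) i.+1));
  last by case: ifP; rewrite ?add0r.
congr (_ + _).
under eq_bigl => i do rewrite single_butS.
under eq_bigr => i _ do rewrite big_ord_recl ins_listS.
case: B => [|b [|b' B]]; try by rewrite big_pred0.
rewrite -(IH (fun w => F (x b :: w))) scaler_sumr.
apply: eq_bigr => i _; by rewrite /= degs_cons degs_nil addr0 sgn2Dr scalerA.
Qed.

Lemma nth_block_lists (P : {set {set 'I_n}}) j : (j < size (blocks P))%N ->
  nth [::] (block_lists P) j = enum (nth set0 (blocks P) j).
Proof. exact: (nth_map set0). Qed.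

Lemma sumPi_psum (F : seq V -> W) :
  sumPi ds x F g = psum ds (enum 'I_n) (fun L => osum ds x 1 (fun a => g (map x a)) L F).
Proof.
rewrite -sum_partitions; apply: eq_bigr => P _.
rewrite -sum_osum scaler_sumr size_map.
rewrite big_seq_cond [RHS]big_seq_cond; apply: eq_big => [i|i].
  apply: andb_id2l => iP; rewrite /others_single /single_but size_map.
  apply: eq_in_all => j; rewrite mem_iota /= => jP.
  by rewrite nth_block_lists // -cardE.
rewrite mem_iota => /andP[/= iP _]; rewrite -scalerA; congr (_ *: (_ *: F _)).
  (* The operation has degree 1, and [sgn2 k 1 b] is convertible to [sgn1 k b]. *)
  congr (sgn1 _ _); apply: eq_bigr => j _.
  rewrite nth_block_lists ?(ltn_trans (ltn_ord j)) //.
  by rewrite /degs big_enum.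
rewrite /ins /ins_list size_map; congr flatten; apply/eq_in_map => j.
by rewrite mem_iota /= => jP; rewrite nth_block_lists.
Qed.

Lemma sumP_psum (U : lmodType k) (F : seq U -> U) (f : seq V -> U) :
  sumP ds x F f = psum ds (enum 'I_n) (fun L => F (map (fun B => f (map x B)) L)).
Proof.
rewrite -sum_partitions; apply: eq_bigr => P _; congr (_ *: F _).
by rewrite /block_lists -map_comp.
Qed.

End FrozenSum.

(** * Graded spaces and multilinear extension *)

Section Graded.
Context {k : fieldType} {V : lmodType k} {pr : int -> V -> V} (gV : is_grading pr).
Implicit Types (d e : int) (u v w : V).

Lemma pr_linear d : linear_map (pr d).
Proof. by case: gV => prL _ _ a u v; apply: prL. Qed.

Lemma pr_pr d e v : pr d (pr e v) = if d == e then pr e v else 0.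
Proof. by case: gV. Qed.

Lemma homog_pr d v : homog pr d (pr d v).
Proof. by rewrite /homog pr_pr eqxx. Qed.

Lemma homog_subspace d : is_subspace (homog pr d).
Proof.
split=> [|a u v hu hv]; first exact: linear_map0 (pr_linear d).
by rewrite /homog pr_linear hu hv.
Qed.

Lemma pr_homog d e v : homog pr d v -> pr e v = if e == d then v else 0.
Proof. by move=> hv; rewrite -{1}hv pr_pr hv. Qed.

(** A grading only asserts that a finite list of degrees exists, so one is chosen; it may contain
    degrees in which the component is zero. *)
Definition supp v : seq int :=
  sval (boolp.cid (let: And3 _ _ h := gV in h v)).

Lemma supp_uniq v : uniq (supp v).
Proof. by rewrite /supp; case: boolp.cid => s []. Qed.

Lemma supp_sum v : v = \sum_(d <- supp v) pr d v.
Proof. by rewrite /supp; case: boolp.cid => s []. Qed.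

Lemma supp_out d v : d \notin supp v -> pr d v = 0.
Proof.
move=> dv; rewrite (supp_sum v) (linear_map_sum (pr_linear d)) big_seq big1 // => e ev.
by rewrite pr_pr; case: eqP => // de; rewrite -de (negPf dv) in ev.
Qed.

Fixpoint homs (ds : seq int) (vs : seq V) : Prop :=
  match ds, vs with
  | [::], [::] => True
  | d :: ds', v :: vs' => homog pr d v /\ homs ds' vs'
  | _, _ => False
  end.

Lemma homs_cat ds es vs ws : homs ds vs -> homs es ws -> homs (ds ++ es) (vs ++ ws).
Proof. by elim: ds vs => [|d ds IH] [|v vs] //= [hv hvs] hws; split=> //; apply: IH. Qed.

Lemma homs_map (T : Type) (deg : T -> int) (xv : T -> V) (s : seq T) :
  (forall t, homog pr (deg t) (xv t)) -> homs (map deg s) (map xv s).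
Proof. by move=> hx; elim: s => //= t s IH; split. Qed.

Lemma homs_size ds vs : homs ds vs -> size ds = size vs.
Proof. by elim: ds vs => [|d ds IH] [|v vs] //= [_ /IH ->]. Qed.

Lemma homs_nth ds vs v0 i : homs ds vs -> (i < size vs)%N ->
  homog pr (nth 0 ds i) (nth v0 vs i).
Proof.
elim: ds vs i => [|d ds IH] [|v vs] [|i] //= [hv hvs] //; exact: IH.
Qed.

Lemma args_nth v0 vs : args (fun i : 'I_(size vs) => nth v0 vs i) = vs.
Proof.
by rewrite /args -[RHS](mkseq_nth v0) /mkseq -val_enum_ord -map_comp.
Qed.

Lemma has_degree_homs (W : lmodType k) (prW : int -> W -> W) d (f : seq V -> W) ds vs :
  has_degree pr prW d f -> homs ds vs -> (0 < size vs)%N ->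
  homog prW (\sum_(e <- ds) e + d) (f vs).
Proof.
move=> df hvs vs0.
have := df _ (fun i : 'I_(size vs) => nth 0 vs i) (fun i => nth 0 ds i) vs0.
rewrite args_nth (big_nth 0) (homs_size hvs) big_mkord; apply => i.
exact: homs_nth.
Qed.

Section Extension.
Context {W : lmodType k}.
Implicit Types (G : seq (int * V) -> W) (xs l r : seq V) (s t : seq (int * V)).

(** Components outside the chosen support vanish, so sums over the supports of different vectors can
    be compared over a common larger list. *)
Lemma supp_sumE (g : int -> V -> W) v (r : seq int) : (forall d, g d 0 = 0) -> uniq r ->
  {subset supp v <= r} ->
  \sum_(d <- supp v) g d (pr d v) = \sum_(d <- r) g d (pr d v).
Proof.
move=> g0 ur sr; rewrite [RHS](bigID (mem (supp v))) /= [X in _ + X]big1 ?addr0.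
  rewrite -[RHS]big_filter; apply: perm_big; apply: uniq_perm; rewrite ?filter_uniq ?supp_uniq //.
  by move=> d; rewrite mem_filter; apply/idP/andP => [dv|[]//]; split=> //; apply: sr.
by move=> d /supp_out ->.
Qed.

Lemma supp_linear (g : int -> V -> W) : (forall d, linear_map (g d)) ->
  linear_map (fun v => \sum_(d <- supp v) g d (pr d v)).
Proof.
move=> gL a u v; pose r := undup (supp (a *: u + v) ++ supp u ++ supp v).
have g0 d : g d 0 = 0 by apply: linear_map0 (gL d).
rewrite !(@supp_sumE g _ r) ?undup_uniq //;
  try by move=> d dv; rewrite mem_undup !mem_cat dv ?orbT.
rewrite scaler_sumr -big_split; apply: eq_bigr => d _ /=.
by rewrite pr_linear gL.
Qed.

Lemma supp_homog (g : int -> V -> W) d v : (forall e, g e 0 = 0) -> homog pr d v ->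
  \sum_(e <- supp v) g e (pr e v) = g d v.
Proof.
move=> g0 hv; rewrite (@supp_sumE g _ (undup (d :: supp v))) ?undup_uniq // => [|e ev].
  rewrite (bigD1_seq d) ?undup_uniq ?mem_undup ?mem_head //= big1 ?addr0 ?hv // => e ed.
  by rewrite (pr_homog _ hv) (negPf ed).
by rewrite mem_undup inE ev orbT.
Qed.

(* Koszul signs need a degree for each argument, so operations are first defined
   on lists of labelled vectors [(d, v)], [v] standing for a vector of degree [d]. *)
Fixpoint ext G xs : W :=
  if xs is x :: xs' then \sum_(d <- supp x) ext (fun t => G ((d, pr d x) :: t)) xs'
  else G [::].

Definition slotwise_linear G := forall s t d, linear_map (fun w => G (s ++ (d, w) :: t)).

Lemma ext_lin a G G' xs :
  ext (fun t => a *: G t + G' t) xs = a *: ext G xs + ext G' xs.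
Proof.
elim: xs G G' => //= x xs IH G G'; rewrite scaler_sumr -big_split.
by apply: eq_bigr => d _; apply: IH.
Qed.

Lemma extZ a G xs : ext (fun t => a *: G t) xs = a *: ext G xs.
Proof.
elim: xs G => //= x xs IH G; rewrite scaler_sumr.
by apply: eq_bigr => d _; apply: IH.
Qed.

Lemma slotwise_linear_cons G p : slotwise_linear G -> slotwise_linear (fun t => G (p :: t)).
Proof. by move=> GL l; apply: (GL (p :: l)). Qed.

Lemma ext_cons_linear G d r : slotwise_linear G ->
  linear_map (fun w => ext (fun t => G ((d, w) :: t)) r).
Proof.
move=> GL a u v; rewrite -ext_lin; congr ext; apply: boolp.funext => t.
exact: (GL [::]).
Qed.

Lemma ext_linear G l r : slotwise_linear G -> linear_map (fun w => ext G (l ++ w :: r)).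
Proof.
elim: l G => [|x l IH] G GL a u v /=.
  by apply: (@supp_linear (fun d w => ext (fun t => G ((d, w) :: t)) r)) => d; apply: ext_cons_linear.
rewrite scaler_sumr -big_split; apply: eq_bigr => d _ /=.
by apply: IH; apply: slotwise_linear_cons.
Qed.

Lemma ext_homog_cons G d x xs : slotwise_linear G -> homog pr d x ->
  ext G (x :: xs) = ext (fun t => G ((d, x) :: t)) xs.
Proof.
move=> GL hx; apply: (@supp_homog (fun d w => ext (fun t => G ((d, w) :: t)) xs)) => // e.
exact: linear_map0 (ext_cons_linear e xs GL).
Qed.

Lemma ext_homs G ds xs : slotwise_linear G -> homs ds xs -> ext G xs = G (zip ds xs).
Proof.
elim: ds xs G => [|d ds IH] [|x xs] G GL //= [hx hxs].
by rewrite -/(ext G (x :: xs)) (ext_homog_cons _ GL hx) IH //; apply: slotwise_linear_cons.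
Qed.

Lemma ext_swap G l r u v du dv a : slotwise_linear G ->
  homog pr du u -> homog pr dv v ->
  (forall s t, G (s ++ (du, u) :: (dv, v) :: t) = a *: G (s ++ (dv, v) :: (du, u) :: t)) ->
  ext G (l ++ u :: v :: r) = a *: ext G (l ++ v :: u :: r).
Proof.
move=> GL hu hv; elim: l G GL => [|x l IH] G GL Ga.
  rewrite ![[::] ++ _]/= (ext_homog_cons _ GL hu) (ext_homog_cons _ GL hv).
  rewrite (ext_homog_cons _ (slotwise_linear_cons _ GL) hv).
  rewrite (ext_homog_cons _ (slotwise_linear_cons _ GL) hu) -extZ.
  by congr ext; apply: boolp.funext => t; apply: (Ga [::]).
rewrite /= scaler_sumr; apply: eq_bigr => d _; apply: IH.
  exact: slotwise_linear_cons.
by move=> s; apply: (Ga (_ :: s)).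
Qed.

Lemma ext_rcons0 G xs d u : slotwise_linear G -> homog pr d u ->
  (forall t, size t = size xs -> G (rcons t (d, u)) = 0) -> ext G (rcons xs u) = 0.
Proof.
move=> GL hu; elim: xs G GL => [|x xs IH] G GL G0.
  by rewrite [rcons _ _]/= (ext_homog_cons _ GL hu); apply: (G0 [::]).
rewrite /= big1 // => e _; apply: IH; first exact: slotwise_linear_cons.
by move=> t st; apply: (G0 (_ :: t)); rewrite /= st.
Qed.

End Extension.
End Graded.

Section OsumMap.
Context {k : fieldType} {T T' : Type} (deg : T -> int) (deg' : T' -> int).
Context {V W : lmodType k} (f : T -> T') (df : forall x, deg' (f x) = deg x).

Lemma osum_map (xv : T' -> V) d (g : seq T' -> V) L (F : seq V -> W) :
  osum deg' xv d g (map (map f) L) F =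
  osum deg (fun t => xv (f t)) d (fun a => g (map f a)) L F.
Proof.
elim: L F => [|B L IH] F //=; rewrite all_map -map_flatten -map_comp.
congr (_ + _).
  by rewrite (eq_all (a2 := @single _)) // => a; rewrite /single /= size_map.
by case: B => [|b [|b' B]] //=; rewrite IH df.
Qed.

End OsumMap.

(** * The descendant operations *)

Section Descendant.
Context {k : fieldType} {C : lmodType k} {prC : int -> C -> C} (gC : is_grading prC).
Context {oneC : C} {M : seq C -> C} {K : C -> C} (hpa : is_hpa prC oneC M K).
Context {lK : seq C -> C} (desc : is_descendant prC M K lK).
Context {T : Type} (deg : T -> int) (xv : T -> C).
Hypothesis hx : forall t, homog prC (deg t) (xv t).
Implicit Types (s t a b : seq T) (L : seq (seq T)).

Lemma M_multilinear l r : linear_map (fun w => M (l ++ w :: r)).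
Proof. by case: hpa => _ [mM _ _ _ _] _ _ a u v; apply: mM. Qed.

Lemma M_sym l r u v du dv : homog prC du u -> homog prC dv v ->
  M (l ++ u :: v :: r) = sgn2 k du dv *: M (l ++ v :: u :: r).
Proof. by case: hpa => _ [_ sM _ _ _] _ _; apply: sM. Qed.

Lemma M_homog ds vs : homs (pr := prC) ds vs -> (0 < size vs)%N ->
  homog prC (\sum_(d <- ds) d) (M vs).
Proof.
case: hpa => _ [_ _ dM _ _] _ _ hvs vs0; rewrite -[X in homog _ X]addr0.
exact: has_degree_homs dM hvs vs0.
Qed.

Lemma M1 v : M [:: v] = v.
Proof. by case: hpa => _ [_ _ _ M1 _] _ _. Qed.

Lemma K_linear : linear_map K.
Proof. by case: hpa => _ _ [KL _ _] _ a u v; apply: KL. Qed.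

Lemma K_homog d v : homog prC d v -> homog prC (d + 1) (K v).
Proof. by case: hpa => _ _ [_ dK _] _; apply: dK. Qed.

Notation lKx := (fun a => lK (map xv a)).

Lemma KM_osum s : (0 < size s)%N ->
  K (M (map xv s)) = psum deg s (fun L => osum deg xv 1 lKx L M).
Proof.
move=> s0; pose f (i : 'I_(size s)) := tnth (in_tuple s) i.
have fE : map f (enum 'I_(size s)) = s by exact: map_tnth_enum (in_tuple s).
have := desc (x := fun i => xv (f i)) (ds := fun i => deg (f i)) s0 (fun i => hx _).
rewrite sumPi_psum /args.
have -> : [seq xv (f i) | i <- enum 'I_(size s)] = map xv s.
  by rewrite (map_comp xv f) fE.
move=> ->; transitivity (psum deg (map f (enum 'I_(size s)))
    (fun L => osum deg xv 1 lKx L M)); last by rewrite fE.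
rewrite (psum_map (deg := fun i => deg (f i))) //; apply: eq_psum => L _.
rewrite (osum_map (deg := fun i => deg (f i))) //; congr osum.
by apply: boolp.funext => a; rewrite -map_comp.
Qed.

Lemma homs_ins s1 s2 d v : homog prC d v ->
  homs (pr := prC) (map deg s1 ++ d :: map deg s2) (map xv s1 ++ v :: map xv s2).
Proof. by move=> hv; apply: homs_cat; [|split]; rewrite //; apply: homs_map. Qed.

Lemma psum_gt1 s F : psum deg s F = F (if s is [::] then [::] else [:: s]) +
  psum deg s (fun L => if (1 < size L)%N then F L else 0 : C).
Proof.
rewrite -(@psum_le1 _ _ deg _ s F) -psumD; apply: eq_psum => L _.
by case: leqP; rewrite ?addr0 ?add0r.
Qed.

(** The recursion forces this degree. Since [M [:: v] = v], its one-block term is [lK] of all the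
    arguments, and the remaining terms apply [lK] to shorter blocks only. *)
Lemma descendant_homog s : (0 < size s)%N -> homog prC (degs deg s + 1) (lK (map xv s)).
Proof.
have [m] := ubnP (size s); elim: m s => // m IH s sm s0.
have hQ := homog_subspace gC (degs deg s + 1).
have := KM_osum s0; rewrite psum_gt1.
have -> : (if s is [::] then [::] else [:: s]) = [:: s] by case: (s) s0.
have -> : osum deg xv 1 lKx [:: s] M = lK (map xv s).
  by rewrite /= M1; case: (s) => [|b [|b' t]]; rewrite ?scaler0 addr0.
move=> /esym eK.
have -> : lK (map xv s) = K (M (map xv s)) + (-1) *: psum deg s (fun L =>
    if (1 < size L)%N then osum deg xv 1 lKx L M else 0).
  by rewrite scaleN1r -eK addrK.
apply: (subspaceD hQ).
  apply: K_homog; have := M_homog (homs_map s hx); rewrite size_map big_map.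
  exact.
apply: (subspaceZ hQ); apply: (psum_ind hQ) => L bL.
case: ifP => L1; last exact: hQ.1.
apply: (osum_ind deg hQ) => L2 B L3 eL sL2 sL3.
have nB : nonnil B.
  by have := nonnil_blocks bL; rewrite eL => /nonnil_cat.
have [sL _ dL] := bL.
have sB : (size B < m)%N.
  move: sL (nonnil_blocks bL) L1; rewrite eL flatten_cat /= !size_cat /= all_cat /=.
  move: sm; case: L2 {eL sL2} => [|[|? ?] L2] /=; case: L3 {sL3} => [|[|? ?] L3] //=;
  rewrite ?size_cat /=; lia.
have hB := IH B sB; rewrite /nonnil -lt0n in nB.
have := M_homog (homs_ins (flatten L2) (flatten L3) (hB nB)).
rewrite size_cat addnS => /(_ isT); rewrite big_cat big_cons !big_map.
rewrite -[X in homog _ X _]/(degs deg (flatten L2) + (degs deg B + 1 + degs deg (flatten L3))).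
rewrite -dL eL flatten_cat /= !degs_cat.
by congr (homog _ _ _); ring.
Qed.

(** Knowing the degree of [lK], graded symmetry of [M] brings its value to the first slot. This is
    the form of the recursion to which [psum_bsum] applies. *)
Lemma KM_usum s : (0 < size s)%N ->
  K (M (map xv s)) =
  usum deg s (fun a b => if nonnil a then M (lK (map xv a) :: map xv b) else 0).
Proof.
move=> s0; rewrite KM_osum // psum_osum // => l t a r a0.
by apply: M_sym => //; apply: descendant_homog; rewrite lt0n.
Qed.

End Descendant.

(** * Moments and cumulants *)

Section Inversion.
Context {k : fieldType} {C : lmodType k} {prC : int -> C -> C} (gC : is_grading prC).
Context {oneC : C} {M : seq C -> C} {K : C -> C} (hpa : is_hpa prC oneC M K).
Context {T : Type} (deg : T -> int) (Phi : seq T -> C).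
Implicit Types (s t l r : seq T) (L : seq (seq T)).

(* [m] bounds the recursion depth: [size s] suffices. *)
Fixpoint cumulantf m s : C :=
  if m is m'.+1 then
    Phi s - psum deg s (fun L => if (1 < size L)%N then M (map (cumulantf m') L) else 0)
  else 0.

Definition cumulant s := cumulantf (size s) s.

Lemma blocks_size s L1 B L2 : blocks_of deg s (L1 ++ B :: L2) ->
  (1 < size (L1 ++ B :: L2))%N -> (size B < size s)%N.
Proof.
move=> bL; have [sL _ _] := bL; move: sL (nonnil_blocks bL).
rewrite flatten_cat /= !size_cat /= all_cat /= => <-.
case: L1 {bL} => [|[|? ?] L1]; case: L2 => [|[|? ?] L2] //=; rewrite ?size_cat /=; lia.
Qed.

Lemma cumulantf_fuel m m' s : (size s <= m)%N -> (size s <= m')%N -> (0 < size s)%N ->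
  cumulantf m s = cumulantf m' s.
Proof.
elim: m m' s => [|m IH] [|m'] s //=; rewrite ?leqn0 => sm sm' s0; try lia.
congr (_ - _); apply: eq_psum => L bL; case: ifP => // L1; congr M.
have : forall B, (exists L1 L2, L = L1 ++ B :: L2) -> cumulantf m B = cumulantf m' B.
  move=> B [L2 [L3 eL]]; rewrite eL in bL L1.
  have sB := blocks_size bL L1; have := nonnil_cat (nonnil_blocks bL).
  by rewrite /nonnil -lt0n => B0; apply: IH => //; lia.
elim: (L) => //= B L' IHL E; rewrite E; last by exists [::], L'.
by rewrite IHL // => B' [L2 [L3 eL]]; apply: E; exists (B :: L2), L3; rewrite eL.
Qed.

Lemma psum_cumulant s : (0 < size s)%N -> psum deg s (fun L => M (map cumulant L)) = Phi s.
Proof.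
move=> s0; rewrite psum_gt1 (_ : (if s is [::] then _ else _) = [:: s]); last by case: (s) s0.
have -> : Phi s = cumulant s + psum deg s (fun L =>
    if (1 < size L)%N then M (map (cumulantf (size s).-1) L) else 0).
  by rewrite /cumulant; case: (size s) s0 => //= m _; rewrite subrK.
rewrite /= (M1 hpa); congr (_ + _); apply: eq_psum => L bL; case: ifP => // L1; congr M.
have : forall B, (exists L1 L2, L = L1 ++ B :: L2) -> cumulant B = cumulantf (size s).-1 B.
  move=> B [L2 [L3 eL]]; rewrite eL in bL L1.
  have sB := blocks_size bL L1; have := nonnil_cat (nonnil_blocks bL).
  by rewrite /nonnil -lt0n => B0; apply: cumulantf_fuel => //; lia.
elim: (L) => //= B L' IHL E; rewrite E; last by exists [::], L'.
by rewrite IHL // => B' [L2 [L3 eL]]; apply: E; exists (B :: L2), L3; rewrite eL.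
Qed.

Lemma cumulantf_linear (V : lmodType k) (e : V -> T) (d : int) m l r :
  (forall w, deg (e w) = d) ->
  (forall l r, linear_map (fun w => Phi (l ++ e w :: r))) ->
  linear_map (fun w => cumulantf m (l ++ e w :: r)).
Proof.
move=> de PL; elim: m l r => [|m IH] l r a u v /=; first by rewrite scaler0 addr0.
rewrite PL (@linear_slot_psum _ _ deg _ _ e d) //.
  by rewrite scalerBr opprD addrACA.
move=> L1 L2 l' r' b w w'; rewrite !size_cat /=.
case: ifP => _; last by rewrite scaler0 addr0.
rewrite !map_cat /= IH; exact: M_multilinear hpa _ _ _ _ _.
Qed.

Hypothesis Phi_homog : forall s, homog prC (degs deg s) (Phi s).
Hypothesis Phi_sym : forall l r u v,
  Phi (l ++ u :: v :: r) = sgn2 k (deg u) (deg v) *: Phi (l ++ v :: u :: r).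

Lemma cumulantf_homog m s : homog prC (degs deg s) (cumulantf m s).
Proof.
have hQ := homog_subspace gC (degs deg s).
elim: m s hQ => [|m IH] s hQ /=; first exact: hQ.1.
apply: (subspaceD hQ) => //; rewrite -scaleN1r; apply: (subspaceZ hQ).
apply: (psum_ind hQ) => L [sL aL <-]; case: ifP => L1; last exact: linear_map0 (pr_linear gC _).
have hL : homs (pr := prC) (map (degs deg) L) (map (cumulantf m) L).
  by apply: homs_map => B; apply: IH; apply: homog_subspace.
have := M_homog hpa hL; rewrite size_map => /(_ (ltnW L1)).
by rewrite big_map -/(degs (degs deg) L) degs_flatten.
Qed.

Lemma cumulant_homog s : homog prC (degs deg s) (cumulant s).
Proof. exact: cumulantf_homog. Qed.

Lemma M_map_sym_blocks (f : seq T -> C) : (forall s, homog prC (degs deg s) (f s)) ->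
  sym_blocks deg (fun L => if (1 < size L)%N then M (map f L) else 0).
Proof.
move=> fh L1 L2 A B; rewrite !size_cat /=; case: ifP => _; last by rewrite scaler0.
by rewrite !map_cat /=; apply: (M_sym hpa).
Qed.

Lemma M_map_sym_in_blocks (f : seq T -> C) :
  (forall l r u v, f (l ++ u :: v :: r) = sgn2 k (deg u) (deg v) *: f (l ++ v :: u :: r)) ->
  sym_in_blocks deg (fun L => if (1 < size L)%N then M (map f L) else 0).
Proof.
move=> fs L1 L2 l r u v; rewrite !size_cat /=; case: ifP => _; last by rewrite scaler0.
rewrite !map_cat /= fs; exact: linear_mapZ (M_multilinear hpa _ _) _ _.
Qed.

Lemma cumulantf_sym m l r u v :
  cumulantf m (l ++ u :: v :: r) = sgn2 k (deg u) (deg v) *: cumulantf m (l ++ v :: u :: r).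
Proof.
elim: m l r u v => [|m IH] l r u v /=; first by rewrite scaler0.
rewrite Phi_sym scalerBr; congr (_ - _); apply: sym_psum.
  exact: M_map_sym_in_blocks.
by apply: M_map_sym_blocks => s; apply: cumulantf_homog.
Qed.

Lemma cumulant_sym l r u v :
  cumulant (l ++ u :: v :: r) = sgn2 k (deg u) (deg v) *: cumulant (l ++ v :: u :: r).
Proof. by rewrite /cumulant !size_cat /= cumulantf_sym. Qed.

Lemma cumulant1 u : cumulant [:: u] = Phi [:: u].
Proof. by rewrite /cumulant /= addr0 subr0. Qed.

Lemma cumulant_move0 s l r u : deg u = 0 -> cumulant (l ++ s ++ u :: r) = cumulant (l ++ u :: s ++ r).
Proof.
move=> u0; elim: s l => [|x s IH] l //=.
by rewrite -cat_rcons IH cat_rcons cumulant_sym u0 sgn2_0r scale1r.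
Qed.

(** The unit axiom concerns the last slot. The unit has degree 0, so it moves to the front without
    sign, past arguments that have to be homogeneous. *)
Lemma M_one_cons ds vs : homs (pr := prC) ds vs -> (0 < size vs)%N -> M (oneC :: vs) = M vs.
Proof.
case: hpa => h1 [_ _ _ _ MU] _ _ hvs vs0.
rewrite -(MU vs); last by case: (vs) vs0.
suff H : forall l : seq C, M (l ++ oneC :: vs) = M (l ++ rcons vs oneC) by apply: (H [::]).
elim: ds vs hvs {vs0} => [|d ds IH] [|v vs] //= [hv hvs] l.
by rewrite (M_sym hpa _ _ h1 hv) sgn2_0l scale1r -cat_rcons IH // cat_rcons.
Qed.

(** Expand both sides of [Phi (u :: s) = Phi s] in cumulants. The partitions in which [u] is alone
    already give [Phi s], so those in which it joins a block of [s] sum to zero. By induction the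
    only one of these that can contribute is the one-block term. *)
Lemma cumulant_unit u s : deg u = 0 -> Phi [:: u] = oneC ->
  (forall t, (0 < size t)%N -> Phi (u :: t) = Phi t) ->
  (0 < size s)%N -> cumulant (u :: s) = 0.
Proof.
move=> u0 Pu PU; have [m] := ubnP (size s); elim: m s => // m IH s sm s0.
have := psum_cumulant (isT : (0 < size (u :: s))%N).
rewrite PU // -(psum_cumulant s0) /= psumD.
have -> : psum deg s (fun L => M (map cumulant ([:: u] :: L))) = psum deg s (fun L => M (map cumulant L)).
  apply: eq_psum => L [sL _ _]; rewrite /= cumulant1 Pu.
  have hL : homs (pr := prC) (map (degs deg) L) (map cumulant L).
    by apply: homs_map => B; apply: cumulant_homog.
  apply: M_one_cons hL _; rewrite size_map.
  by case: (L) sL s0 => //= <-.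
move/(canRL (addKr _)); rewrite addNr psum_gt1.
rewrite (_ : (if s is [::] then _ else _) = [:: s]); last by case: (s) s0.
rewrite /= (M1 hpa) scaler0 addr0 psum0 ?addr0 // => L bL; case: ifP => // L1.
apply: (isum_ind deg subspace0) => L2 B L3 eL; rewrite eL in bL L1.
have nB := nonnil_cat (nonnil_blocks bL); rewrite /nonnil -lt0n in nB.
rewrite map_cat /= (IH B) //; last by have := blocks_size bL L1; lia.
exact: linear_map0 (M_multilinear hpa _ _).
Qed.

Context {lK : seq C -> C} (desc : is_descendant prC M K lK).

(* Expanding [K M] in [K Phi(s) = 0] gives a sum over unshuffles [(a, b)] of [s]
   in which the expression to be killed appears for each [a]; by induction only
   the term [a = s] is left. *)
Lemma psum_descendant_cumulant s : (forall t, (0 < size t)%N -> K (Phi t) = 0) ->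
  (0 < size s)%N -> psum deg s (fun L => lK (map cumulant L)) = 0.
Proof.
move=> KPhi; have [m] := ubnP (size s); elim: m s => // m IH s sm s0.
have := KPhi s s0; rewrite -psum_cumulant // (psum_linear _ (K_linear hpa)).
rewrite (eq_psum (G := fun P => usum (degs deg) P (fun Q R =>
  if nonnil Q then M (lK (map cumulant Q) :: map cumulant R) else 0))); last first.
  move=> L [sL _ _]; apply: (KM_usum gC hpa desc cumulant_homog).
  by case: (L) sL s0 => //= <-.
rewrite psum_bsum.
pose E a b := psum deg b (fun R => M (psum deg a (fun Q => lK (map cumulant Q)) :: map cumulant R)).
have EL b : linear_map (fun w => psum deg b (fun R => M (w :: map cumulant R))).
  move=> a u v; rewrite -psumZ -psumD; apply: eq_psum => R _.
  exact: (M_multilinear hpa [::]).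
(* A partition [Q] of [a] is empty exactly when [a] is, so the condition on [Q] becomes one on [a].
   Linearity of [M] in its first slot then gathers the sum over [Q]. *)
rewrite (@eq_usum _ _ _ _ s _ (fun a b => if nonnil a then E a b else 0)); last first.
  move=> a b _; case: ifP => na; rewrite /nonnil in na.
    rewrite /E (psum_linear _ (EL b)); apply: eq_psum => Q [sQ _ _].
    by rewrite (_ : nonnil Q) //; case: (Q) sQ na => //= <-.
  apply: psum0 => Q [sQ aQ _]; apply: psum0 => R _.
  by case: (Q) sQ aQ => //= B Q'; rewrite size_cat => sQ /andP[/negPf nB _]; lia.
rewrite usum_only_l.
  rewrite (_ : nonnil s); last by rewrite /nonnil -lt0n.
  by rewrite /E /= (M1 hpa).
move=> a b ab b0; case: ifP => // na; rewrite /E IH; last 2 first.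
- by lia.
- by rewrite lt0n.
exact: linear_map0 (EL b).
Qed.

End Inversion.

(** * A graded section of the cohomology projection *)

Section CohomologySection.
Context {k : fieldType} {C H : lmodType k} {prC : int -> C -> C} {prH : int -> H -> H}.
Context {K : C -> C} {p : C -> H}.
Hypotheses (gC : is_grading prC) (gH : is_grading prH) (coh : is_cohomology prC K prH p).
Variable oneC : C.
Hypotheses (KL : linear_map K) (homog1 : homog prC 0 oneC) (K1 : K oneC = 0).
Hypothesis p1 : p oneC <> 0.

Lemma p_linear : linear_map p.
Proof. by case: coh => pL _ _ _ a u v; apply: pL. Qed.

(** A section is built through its image: a graded space of cocycles containing the unit on which
    [p] is injective. Gradedness makes the resulting section preserve degrees, and membership of the
    unit makes it unital. *)
Definition partial_section (Z : C -> Prop) :=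
  [/\ is_subspace Z, (forall d z, Z z -> Z (prC d z)), (forall z, Z z -> K z = 0),
      (forall z, Z z -> p z = 0 -> z = 0) & Z oneC].

Lemma partial_section_unit : partial_section (fun z => exists a : k, z = a *: oneC).
Proof.
split.
- split=> [|a _ _ [b ->] [c ->]]; first by exists 0; rewrite scale0r.
  by exists (a * b + c); rewrite scalerDl scalerA.
- move=> d _ [a ->]; rewrite (linear_mapZ (pr_linear gC d)) (pr_homog gC d homog1).
  by case: ifP => _; [exists a | exists 0; rewrite scaler0 scale0r].
- by move=> _ [a ->]; rewrite (linear_mapZ KL) K1 scaler0.
- move=> _ [a ->]; rewrite (linear_mapZ p_linear) => /eqP; rewrite scaler_eq0.
  by case/orP => /eqP // ->; rewrite scale0r.
- by exists 1; rewrite scale1r.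
Qed.

Lemma partial_section_extend Z d z : partial_section Z ->
  homog prC d z -> K z = 0 -> (forall y, Z y -> p y <> p z) ->
  partial_section (fun x => exists y (a : k), Z y /\ x = y + a *: z).
Proof.
move=> [Zs Zpr ZK Zp Z1] hz Kz pz; split.
- split=> [|a _ _ [y [b [Zy ->]]] [y' [b' [Zy' ->]]]].
    by exists 0, 0; rewrite scale0r addr0; split=> //; apply: Zs.1.
  exists (a *: y + y'), (a * b + b'); split; first exact: Zs.2.
  by rewrite scalerDr scalerDl scalerA addrACA.
- move=> e _ [y [a [Zy ->]]].
  rewrite (linear_mapD (pr_linear gC e)) (linear_mapZ (pr_linear gC e)) (pr_homog gC e hz).
  exists (prC e y), (if e == d then a else 0); split; first exact: Zpr.
  by case: ifP => _; rewrite ?scaler0 ?scale0r.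
- by move=> _ [y [a [Zy ->]]]; rewrite (linear_mapD KL) (linear_mapZ KL) Kz ZK // scaler0 addr0.
- move=> _ [y [a [Zy ->]]]; rewrite (linear_mapD p_linear) (linear_mapZ p_linear).
  have [->|a0] := eqVneq a 0; first by rewrite !scale0r !addr0; apply: Zp.
  move/eqP; rewrite addr_eq0 => /eqP py; case: (pz (- a^-1 *: y)).
    exact: subspaceZ.
  by rewrite (linear_mapZ p_linear) py scalerN scaleNr opprK scalerA mulVf // scale1r.
- by exists oneC, 0; split; rewrite // scale0r addr0.
Qed.

Lemma exists_section_space :
  exists2 Z, partial_section Z & forall h, exists2 z, Z z & p z = h.
Proof.
pose P (A : C -> Prop) := (forall z, ~ A z) \/ partial_section A.
have [F FP Ftot|A [PA Amax]] := @classical_sets.Zorn_bigcup C P.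
  have [[A FA gA]|noA] := boolp.pselect (exists2 A, F A & partial_section A); last first.
    by left=> z [A FA Az]; case: (FP _ FA) => [/(_ z)|gA]; [apply | apply: noA; exists A].
  right; have gF B z : F B -> B z -> partial_section B.
    by move=> FB Bz; case: (FP _ FB) => // /(_ z).
  split.
  - split=> [|a u v [B FB Bu] [B' FB' Bv]].
      by exists A => //; case: gA => -[].
    have [BB'|B'B] := Ftot _ _ FB FB'.
      exists B' => //; have [[_ sB'] _ _ _ _] := gF _ _ FB' Bv.
      by apply: sB' => //; apply: BB'.
    exists B => //; have [[_ sB] _ _ _ _] := gF _ _ FB Bu.
    by apply: sB => //; apply: B'B.
  - by move=> d z [B FB Bz]; exists B => //; have [_ h _ _ _] := gF _ _ FB Bz; apply: h.
  - by move=> z [B FB Bz]; have [_ _ h _ _] := gF _ _ FB Bz; apply: h.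
  - by move=> z [B FB Bz]; have [_ _ _ h _] := gF _ _ FB Bz; apply: h.
  - by exists A => //; case: gA.
have gA : partial_section A.
  (* A maximal element is not empty: the line spanned by the unit would be larger. *)
  case: PA => // A0; case: (Amax (fun z => exists a : k, z = a *: oneC)).
    split=> [z /A0 //|/(_ oneC)/=]; move=> h; apply: (A0 oneC); apply: h.
    by exists 1; rewrite scale1r.
  by right; apply: partial_section_unit.
exists A => // h; apply: boolp.contrapT => nh.
(* If [h] is missed, so is one of its homogeneous components, since lifts of all of them would add
   up to a lift of [h]. A homogeneous cocycle over the missed component then enlarges [A]. *)
have [d nd] : exists d, forall y, A y -> p y <> prH d h.
  apply: boolp.contrapT => nd; apply: nh.
  have {}nd d : exists2 y, A y & p y = prH d h.
    apply: boolp.contrapT => nd'; apply: nd; exists d => y Ay py.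
    by apply: nd'; exists y.
  have [[sA1 sA2] _ _ _ _] := gA.
  rewrite (supp_sum gH h); elim: (supp gH h) => [|e s [z Az pz]].
    by exists 0; rewrite ?big_nil // (linear_map0 p_linear).
  have [y Ay py] := nd e; exists (1 *: y + z); first exact: sA2.
  by rewrite big_cons scale1r (linear_mapD p_linear) py pz.
case: coh => _ _ lift _; have [z [hz Kz pz]] := lift d _ (homog_pr gH d h).
have pzA y : A y -> p y <> p z by rewrite pz; apply: nd.
case: (Amax _ _ (or_intror (partial_section_extend gA hz Kz pzA))).
split=> [y Ay|/(_ z)/= zA]; first by exists y, 0; rewrite scale0r addr0.
apply: (pzA z) => //; apply: zA; exists 0, 1; rewrite scale1r add0r; split=> //.
by case: gA => -[].
Qed.

Lemma exists_section : exists f : H -> C,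
  [/\ linear_map f, forall d h, homog prH d h -> homog prC d (f h),
      forall h, K (f h) = 0, forall h, p (f h) = h & f (p oneC) = oneC].
Proof.
have [Z [Zs Zpr ZK Zp Z1] Zsurj] := exists_section_space.
have [f fP] : exists f : H -> C, forall h, Z (f h) /\ p (f h) = h.
  have Zsurj' h : exists z, Z z /\ p z = h by have [z Zz pz] := Zsurj h; exists z.
  by exists (fun h => sval (boolp.cid (Zsurj' h))) => h; case: boolp.cid.
have Zf h : Z (f h) by case: (fP h).
have pf h : p (f h) = h by case: (fP h).
have ZI x y : Z x -> Z y -> p x = p y -> x = y.
  move=> Zx Zy pxy; apply/eqP; rewrite -subr_eq0; apply/eqP; apply: Zp.
    by rewrite -scaleN1r addrC; apply: Zs.2.
  by rewrite (linear_mapB p_linear) pxy subrr.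
exists f; split=> //.
- move=> a u v; apply: ZI => //; first exact: Zs.2.
  by rewrite p_linear !pf.
- move=> d h hh; apply: ZI => //; first exact: Zpr.
  (* By injectivity of [p] on [Z] it suffices to compare the images under [p]. As [p] respects the
     degrees of cocycles, the degree [d] component of [f h] maps to that of [h], which is [h]
     itself. *)
  have homogp e : homog prH e (p (prC e (f h))).
    by case: coh => _ hp _ _; apply: hp; [apply: homog_pr | apply: ZK; apply: Zpr].
  rewrite pf -[RHS]hh -[in RHS](pf h) [in RHS](supp_sum gC (f h)).
  rewrite (linear_map_sum p_linear) (linear_map_sum (pr_linear gH d)).
  under eq_bigr => e _ do rewrite (pr_homog gH d (homogp e)).
  have [ds|ds] := boolP (d \in supp gC (f h)).
    by rewrite (bigD1_seq d) ?supp_uniq //= eqxx big1 ?addr0 // => e /negPf; rewrite eq_sym => ->.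
  rewrite big_seq big1 ?(supp_out ds) ?(linear_map0 p_linear) // => e es.
  by case: eqP => // de; rewrite -de (negPf ds) in es.
- by move=> h; apply: ZK.
- by apply: ZI; rewrite ?pf.
Qed.

End CohomologySection.

(** * Moments built from a section and a normalized functional *)

Section Moments.
Context {k : fieldType} {C H : lmodType k} {prC : int -> C -> C} {prH : int -> H -> H}.
Hypotheses (gC : is_grading prC) (gH : is_grading prH).
Variables (oneC : C) (oneH : H) (f : H -> C) (a : H -> k).
Hypotheses (fL : linear_map f) (homog_f : forall d h, homog prH d h -> homog prC d (f h)).
Hypotheses (f1 : f oneH = oneC) (a1 : a oneH = 1) (homog1 : homog prC 0 oneC).
Hypothesis aL : forall (b : k) u v, a (b *: u + v) = b * a u + a v.
Hypothesis a0 : forall d h, d != 0 -> homog prH d h -> a h = 0.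
Implicit Types (xs l r : seq H) (u v w x : H).

Definition aprod xs := \prod_(x <- xs) a x.

(** Multiplication by [f x] in the algebra where centered parts have product zero: [aprod xs'] is
    the scalar part of the remaining product, and only it can multiply the centered part of [x]. *)
Fixpoint moment xs : C :=
  if xs is x :: xs' then a x *: moment xs' + aprod xs' *: (f x - a x *: oneC) else oneC.

Lemma aprod_cat l w r : aprod (l ++ w :: r) = aprod l * (a w * aprod r).
Proof. by rewrite /aprod big_cat big_cons. Qed.

Lemma moment1 h : moment [:: h] = f h.
Proof. by rewrite /= /aprod big_nil scale1r addrC subrK. Qed.

Lemma moment_unit xs : moment (oneH :: xs) = moment xs.
Proof. by rewrite /= a1 f1 !scale1r subrr scaler0 addr0. Qed.

Lemma centered_linear : linear_map (fun h => f h - a h *: oneC).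
Proof. by move=> b u v; rewrite fL aL scalerDl scalerBr scalerA opprD addrACA. Qed.

Lemma moment_linear l r : linear_map (fun w => moment (l ++ w :: r)).
Proof.
move=> b u v; elim: l => [|x l IH] /=.
  rewrite centered_linear aL; move: (f u - _) (f v - _) => gu gv.
  rewrite scalerDl !scalerDr !scalerA addrACA.
  by congr (_ + _ *: _ + _); ring.
rewrite IH !aprod_cat aL scalerDr [b *: (_ + _)]scalerDr !scalerA addrACA -scalerDl.
by congr (_ *: _ + _ + _ *: _); ring.
Qed.

Lemma moment_swap l r u v : moment (l ++ u :: v :: r) = moment (l ++ v :: u :: r).
Proof.
elim: l => [|x l IH] /=; last first.
  by rewrite IH !aprod_cat /aprod !big_cons [a u * (_ * _)]mulrCA.
rewrite /aprod !big_cons -!/(aprod r) !(scalerDr (a _)) !scalerA [a u * a v]mulrC -!addrA.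
by congr (_ + _); rewrite addrC; congr (_ *: _ + _ *: _); rewrite mulrC.
Qed.

Lemma moment_swap0 l r u v : a u = 0 -> a v = 0 -> moment (l ++ u :: v :: r) = 0.
Proof.
move=> au av; elim: l => [|x l IH] /=.
  by rewrite /aprod !big_cons au av !mul0r !scale0r !addr0.
by rewrite IH aprod_cat au mul0r mulr0 scaler0 scale0r addr0.
Qed.

(** The moments are symmetric without signs. A sign appears only for two odd vectors; [a] kills
    both, and each term of the moment contains at least one of the two factors, so both sides
    vanish. *)
Lemma moment_sym l r u v du dv : homog prH du u -> homog prH dv v ->
  moment (l ++ u :: v :: r) = sgn2 k du dv *: moment (l ++ v :: u :: r).
Proof.
move=> hu hv; rewrite /sgn2; case: ifP => [/andP[ou ov]|_]; last by rewrite scale1r moment_swap.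
have au : a u = 0 by apply: a0 hu; apply: contraTneq ou => ->.
have av : a v = 0 by apply: a0 hv; apply: contraTneq ov => ->.
by rewrite !moment_swap0 // scaler0.
Qed.

Lemma aprod_homs ds xs : homs (pr := prH) ds xs -> \sum_(d <- ds) d != 0 -> aprod xs = 0.
Proof.
elim: ds xs => [|d ds IH] [|x xs] //=; first by rewrite big_nil eqxx.
move=> [hx hxs]; rewrite /aprod !big_cons; have [-> | d0] := eqVneq d 0.
  by rewrite add0r => /(IH _ hxs); rewrite /aprod => ->; rewrite mulr0.
by rewrite (a0 d0 hx) mul0r.
Qed.

(** A coefficient is nonzero only if the arguments it absorbs have total degree 0, so each surviving
    term has the full degree. *)
Lemma moment_homog ds xs : homs (pr := prH) ds xs ->
  homog prC (\sum_(d <- ds) d) (moment xs).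
Proof.
elim: ds xs => [|d ds IH] [|x xs] //=; first by rewrite big_nil.
move=> [hx hxs]; rewrite big_cons; have hQ := homog_subspace gC (d + \sum_(e <- ds) e).
have ha e : e != 0 -> homog prH e x -> a x = 0 by exact: a0.
apply: (subspaceD hQ).
  have [e0|d0] := eqVneq d 0; last by rewrite (a0 d0 hx) scale0r; exact: hQ.1.
  by apply: (subspaceZ hQ); rewrite e0 add0r; apply: IH.
have [e0|e0] := eqVneq (\sum_(e <- ds) e) 0; last by rewrite (aprod_homs hxs e0) scale0r; exact: hQ.1.
apply: (subspaceZ hQ); rewrite -scaleNr; apply: (subspaceD hQ).
  by rewrite e0 addr0; apply: homog_f.
have [d0|d0] := eqVneq d 0; last by rewrite (a0 d0 hx) oppr0 scale0r; exact: hQ.1.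
by apply: (subspaceZ hQ); rewrite e0 d0.
Qed.

Lemma moment_closed (K : C -> C) xs : linear_map K -> K oneC = 0 ->
  (forall h, K (f h) = 0) -> K (moment xs) = 0.
Proof.
move=> KL K1 Kf; elim: xs => //= x xs IH.
by rewrite (linear_mapD KL) !(linear_mapZ KL) (linear_mapB KL) (linear_mapZ KL)
  IH Kf K1 !scaler0 subr0 scaler0 addr0.
Qed.

End Moments.

(** * The unital morphism from cohomology *)

Unset Implicit Arguments.

Theorem theorem6p2 (k : fieldType) (Hchar : [pchar k] =i pred0)
  (C : lmodType k) (prC : int -> C -> C) (HgC : is_grading prC)
  (oneC : C) (M : seq C -> C) (K : C -> C) (Hhpa : is_hpa prC oneC M K)
  (Hexp : exists c : C -> k, is_expectation prC oneC K c)
  (lK : seq C -> C) (HlK : is_descendant prC M K lK)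
  (H : lmodType k) (prH : int -> H -> H) (HgH : is_grading prH)
  (p : C -> H) (Hcoh : is_cohomology prC K prH p)
  (H1 : p oneC <> 0) :
  exists phi : seq H -> C,
    is_unital_sLinf_morphism prH prC (p oneC) oneC (fun _ : seq H => 0) lK phi /\
    (forall h : H, K (phi [:: h]) = 0 /\ p (phi [:: h]) = h).
Proof.
have [homog1 _ _ [K1 _]] := Hhpa; have KL := K_linear Hhpa.
have [f [fL homog_f Kf pf f1]] := exists_section HgC HgH Hcoh KL homog1 K1 H1.
have [c [cL c0 c1 _]] := Hexp.
pose a h := c (f h).
have aL (b : k) u v : a (b *: u + v) = b * a u + a v by rewrite /a fL cL.
have a0 d h : d != 0 -> homog prH d h -> a h = 0.
  by move=> d0 /homog_f; apply: c0.
have a1 : a (p oneC) = 1 by rewrite /a f1.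
have homog1H : homog prH 0 (p oneC) by case: Hcoh => _ hp _ _; apply: hp.
(* Projecting makes the value of every labelled vector homogeneous of its label, even when the pair
   is ill-formed, as the lemmas on letters require for all [t]. *)
pose val (t : int * H) := prH t.1 t.2.
have hval t : homog prH t.1 (val t) by apply: homog_pr.
pose Phi (s : seq (int * H)) := moment oneC f a (map val s).
have Phi_homog s : homog prC (degs fst s) (Phi s).
  by have := moment_homog HgC homog_f homog1 a0 (homs_map s hval); rewrite big_map.
have Phi_sym l r u v : Phi (l ++ u :: v :: r) = sgn2 k u.1 v.1 *: Phi (l ++ v :: u :: r).
  by rewrite /Phi !map_cat /=; apply: (moment_sym _ _ a0).
pose G := @cumulant k C M _ fst Phi.
have GL : slotwise_linear G.
  move=> s t d b u v; rewrite /G /cumulant.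
  (* The recursion bound in [cumulant] is the length of the list, which is the same for all vectors
     in the slot; linearity at a fixed bound applies. *)
  have sz w : size (s ++ (d, w) :: t) = (size s + (size t).+1)%N by rewrite size_cat.
  rewrite !sz; apply: (cumulantf_linear Hhpa (e := pair d) (d := d)) => // l r b' w w'.
  rewrite /Phi !map_cat /= /val /= (pr_linear HgH).
  exact: (moment_linear oneC fL aL).
pose phi := ext HgH G.
have phi_homs ds xs : homs (pr := prH) ds xs -> phi xs = G (zip ds xs) by exact: ext_homs.
have phiE n (x : 'I_n -> H) ds (s : seq 'I_n) : (forall i, homog prH (ds i) (x i)) ->
    phi (map x s) = G (map (fun i => (ds i, x i)) s).
  by move=> hx; rewrite (phi_homs (map ds s)) ?zip_map //; apply: homs_map.
have G1 d h : homog prH d h -> G [:: (d, h)] = f h.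
  by move=> hh; rewrite /G cumulant1 /Phi [map _ _]/= moment1 /val /= hh.
have Gsym := cumulant_sym HgC Hhpa Phi_homog Phi_sym.
have phi1 h : phi [:: h] = f h.
  rewrite /phi /= [in RHS](supp_sum HgH h) (linear_map_sum fL).
  by apply: eq_bigr => d _; apply/G1/homog_pr.
exists phi; split; last by move=> h; rewrite phi1 Kf pf.
split; [split | | by rewrite phi1 | ].
- by move=> l r b u v; apply: ext_linear.
- by move=> l r u v du dv hu hv; apply: (ext_swap _ _ _ GL hu hv) => s t; apply: Gsym.
- move=> n x ds n0 hx; rewrite /args (phiE _ _ ds) // addr0.
  have := cumulant_homog HgC Hhpa Phi_homog (map (fun i => (ds i, x i)) (enum 'I_n)).
  by rewrite /degs big_map big_enum.
- move=> n x ds n0 hx; rewrite sumPi_psum sumP_psum.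
  (* The structure on [H] is zero, so each term on the right is [phi] with a zero argument, which
     vanishes by linearity. *)
  rewrite [RHS]psum0 => [|L _]; last first.
    apply: (osum_ind ds subspace0) => L1 B L2 _ _ _.
    exact: linear_map0 (ext_linear HgH _ _ GL).
  pose j i := (ds i, x i).
  have KPhi s : (0 < size s)%N -> K (Phi s) = 0.
    by move=> _; apply: moment_closed.
  have s0 : (0 < size (map j (enum 'I_n)))%N by rewrite size_map size_enum_ord.
  have := psum_descendant_cumulant HgC Hhpa Phi_homog HlK KPhi s0.
  rewrite (psum_map (deg := ds)) // => <-; apply: eq_psum => L _.
  rewrite -map_comp; congr lK; apply: eq_map => B.
  by rewrite (phiE _ _ ds).
- move=> xs xs0; apply: (ext_rcons0 HgH GL homog1H) => t st.
  (* The unit stands last in the axiom and first in [cumulant_unit]; having degree 0, it changes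
     place without sign. *)
  have := cumulant_move0 HgC Hhpa Phi_homog Phi_sym t [::] [::] (u := (0, p oneC)) erefl.
  rewrite !cat0s cats0 cats1 => eG; rewrite [LHS]eG.
  apply: (cumulant_unit HgC Hhpa Phi_homog) => //.
  + by rewrite /Phi [map _ _]/= moment1 /val /= homog1H f1.
  + by move=> t' _; rewrite /Phi map_cons (_ : val _ = p oneC) ?moment_unit //; apply: homog1H.
  + by rewrite st lt0n size_eq0.
Qed.
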